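(* Let $R$ be an integral domain and $M$ an $R$-module. Let $\mathcal{H} = \ell^2(M)\otimes \ell^2(R^\times)$, and for $m\in M$, $r \in R^\times$ let $U^m, S_r \in B(\mathcal{H})$ be the operators determined by $$U^m(v_n\otimes u_s) = v_{sm+n}\otimes u_s,\qquad S_r(v_n\otimes u_s) = v_n\otimes u_{rs}\qquad (n\in M,\ s\in R^\times).$$ Then for all $m,n\in M$ and $r,s\in R^\times$ the following are true: (1) $U^m$ is a unitary with $U^{-m} = (U^m)^*$. (2) $S_r$ is an isometry, and if $r$ is invertible in $R$ then $S_r$ is a unitary with $S_r^* = S_{r^{-1}}$. (3) The map $\mu: M\to B(\mathcal{H})$, $\mu(m)=U^m$, is a group representation, and $C^*(\mu(M))\cong C^*_r(M)$, the (reduced) group $C^*$-algebra of the discrete abelian group $(M,+)$. (4) The map $\rho: R^\times\to B(\mathcal{H})$, $\rho(r)=S_r$, is a semigroup representation, i.e. $S_{rs}=S_rS_s$. (5) The operators respect the module structure: $U^mS_r = S_rU^{rm}$; $U^mS_{r+s} = S_{r+s}U^{rm}U^{sm}$ whenever $r+s\neq 0$; $U^{m+n}S_r = S_rU^{rm}U^{rn}$; and $S_1 = U^0 = 1_{\mathcal{H}}$.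
   Context: $R^\times$ denotes the multiplicative semigroup $R\setminus\{0\}$ of the integral domain $R$. $\{v_n : n\in M\}$ and $\{u_s : s\in R^\times\}$ denote the standard orthonormal bases of $\ell^2(M)$ and $\ell^2(R^\times)$. $C^*(\mu(M))$ is the $C^*$-subalgebra of $B(\mathcal{H})$ generated by $\{U^m : m \in M\}$. *)

(* Defs.v *)
From HB Require Import structures.
From mathcomp Require Import all_boot all_order all_algebra.
From mathcomp Require Import all_classical all_reals all_analysis.
From mathcomp Require Import complex ring lra.

Set Implicit Arguments.
Unset Strict Implicit.
Unset Printing Implicit Defensive.

Import Order.TTheory GRing.Theory Num.Theory.
Import ComplexField.Normc.

Local Open Scope classical_set_scope.
Local Open Scope ring_scope.

Section Sums.
Context {K : realType}.

(* Unordered sums over an arbitrary index set: [psum] is meant for nonnegative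
   families, [rsum] and [csum] for absolutely summable ones. *)
Definition psum (X : choiceType) (a : X -> K) : \bar K :=
  \esum_(x in [set: X]) (a x)%:E.

Definition rsum (X : choiceType) (a : X -> K) : K :=
  fine (psum (fun x => Num.max (a x) 0)) -
  fine (psum (fun x => Num.max (- a x) 0)).

Definition csum (X : choiceType) (F : X -> K[i]) : K[i] :=
  (rsum (fun x => complex.Re (F x)) +i* rsum (fun x => complex.Im (F x)))%C.

Lemma psum_ge0 (X : choiceType) (a : X -> K) :
  (forall x, 0 <= a x) -> (0 <= psum a)%E.
Proof. by move=> a0; apply: esum_ge0 => x _; rewrite lee_fin. Qed.

Lemma psum_fin (X : choiceType) (a : X -> K) :
  (forall x, 0 <= a x) -> (psum a < +oo)%E -> psum a = (fine (psum a))%:E.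
Proof. by move=> a0 aoo; rewrite fineK// ge0_fin_numE// psum_ge0. Qed.

Lemma psumD (X : choiceType) (a b : X -> K) :
  (forall x, 0 <= a x) -> (forall x, 0 <= b x) ->
  psum (fun x => a x + b x) = (psum a + psum b)%E.
Proof.
by move=> a0 b0; rewrite /psum -esumD// => x _; rewrite lee_fin.
Qed.

Lemma le_psum (X : choiceType) (a b : X -> K) :
  (forall x, a x <= b x) -> (psum a <= psum b)%E.
Proof. by move=> ab; apply: le_esum => x _; rewrite lee_fin. Qed.

Lemma psumZ (X : choiceType) (c : K) (a : X -> K) :
  0 <= c -> (forall x, 0 <= a x) ->
  psum (fun x => c * a x) = (c%:E * psum a)%E.
Proof.
move=> c0 a0; rewrite /psum /esum -ereal_supZl//; last first.
  by apply/set0P; exists 0%E, set0; [exact: fsets_set0|rewrite fsbig_set0].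
congr ereal_sup; apply/seteqP; split=> [_ [A hA <-]|_ [_ [A hA <-] <-]] /=.
  exists (\sum_(x \in A) (a x)%:E)%E; first by exists A.
  by rewrite ge0_mule_fsumr// => x; rewrite lee_fin.
by exists A => //; rewrite ge0_mule_fsumr// => x; rewrite lee_fin.
Qed.

Lemma psum_tens (X Y : choiceType) (a : X -> K) (b : Y -> K) :
  (forall x, 0 <= a x) -> (forall y, 0 <= b y) -> (psum b < +oo)%E ->
  psum (fun p : X * Y => a p.1 * b p.2) = (psum b * psum a)%E.
Proof.
move=> a0 b0 boo; have c0 := fine_ge0 (psum_ge0 b0).
rewrite (psum_fin b0 boo) -psumZ//.
transitivity (\esum_(x in [set: X]) \esum_(y in [set: Y]) (a x * b y)%:E).
  rewrite (esum_esum (J := fun=> [set: Y])); last first.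
    by move=> x y _ _; rewrite lee_fin mulr_ge0.
  by rewrite /psum; congr esum; apply/seteqP; split.
apply: eq_esum => x _.
by rewrite -[LHS]/(psum (fun y => a x * b y)) psumZ// EFinM muleC (psum_fin b0 boo).
Qed.

Lemma rsumB (X : choiceType) (p q : X -> K) :
  (forall x, 0 <= p x) -> (forall x, 0 <= q x) ->
  (psum p < +oo)%E -> (psum q < +oo)%E ->
  rsum (fun x => p x - q x) = fine (psum p) - fine (psum q).
Proof.
move=> p0 q0 pf qf; rewrite /rsum.
set u := fun x => Num.max (p x - q x) 0.
set v := fun x => Num.max (- (p x - q x)) 0.
have u0 x : 0 <= u x by rewrite le_max lexx orbT.
have v0 x : 0 <= v x by rewrite le_max lexx orbT.
have uf : (psum u < +oo)%E.
  by apply: le_lt_trans pf; apply: le_psum => x; rewrite ge_max p0 lerBlDr lerDl q0.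
have vf : (psum v < +oo)%E.
  apply: le_lt_trans qf; apply: le_psum => x.
  by rewrite ge_max q0 opprB lerBlDr lerDl p0.
have : (psum u + psum q = psum v + psum p)%E.
  rewrite -!psumD//; congr psum; apply/funext => x; rewrite /u /v.
  by case: (leP (p x - q x) 0); case: (leP (- (p x - q x)) 0); lra.
rewrite (psum_fin u0)// (psum_fin v0)// (psum_fin p0)// (psum_fin q0)//.
by rewrite -!EFinD => -[]; lra.
Qed.

Definition abs_summable (X : choiceType) (a : X -> K) : Prop :=
  (psum (fun x => `|a x|%R) < +oo)%E.

Lemma abs_summable_posneg (X : choiceType) (a : X -> K) : abs_summable a ->
  exists p q : X -> K,
    [/\ forall x, 0 <= p x, forall x, 0 <= q x,
       (psum p < +oo)%E, (psum q < +oo)%E & a = (fun x => p x - q x)].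
Proof.
move=> ha; exists (fun x => Num.max (a x) 0), (fun x => Num.max (- a x) 0).
split.
- by move=> x; rewrite le_max lexx orbT.
- by move=> x; rewrite le_max lexx orbT.
- by apply: le_lt_trans ha; apply: le_psum => x; rewrite ge_max ler_norm /=.
- apply: le_lt_trans ha; apply: le_psum => x.
  by rewrite ge_max -normrN ler_norm /=.
- apply/funext => x.
  by case: (leP (a x) 0); case: (leP (- a x) 0); lra.
Qed.

Lemma rsumD (X : choiceType) (a b : X -> K) :
  abs_summable a -> abs_summable b ->
  rsum (fun x => a x + b x) = rsum a + rsum b.
Proof.
move=> /abs_summable_posneg[p [q [p0 q0 pf qf ->]]].
move=> /abs_summable_posneg[r [s [r0 s0 rf sf ->]]].
have -> : (fun x => p x - q x + (r x - s x)) =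
    (fun x => (p x + r x) - (q x + s x)) by apply/funext => x; ring.
rewrite !rsumB//; last 4 first.
- by move=> x; rewrite addr_ge0.
- by move=> x; rewrite addr_ge0.
- by rewrite psumD// lte_add_pinfty.
- by rewrite psumD// lte_add_pinfty.
rewrite !psumD// (psum_fin p0)// (psum_fin q0)// (psum_fin r0)//.
by rewrite (psum_fin s0)//= opprD addrACA.
Qed.

Lemma rsumN (X : choiceType) (a : X -> K) :
  rsum (fun x => - a x) = - rsum a.
Proof.
rewrite /rsum opprB.
by have -> : (fun x => Num.max (- - a x) 0) = (fun x => Num.max (a x) 0)
  by apply/funext => x; rewrite opprK.
Qed.

Lemma rsum_tens (X Y : choiceType) (a : X -> K) (b : Y -> K) :
  abs_summable a -> abs_summable b ->
  rsum (fun p : X * Y => a p.1 * b p.2) = rsum a * rsum b.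
Proof.
move=> /abs_summable_posneg[p [q [p0 q0 pf qf ->]]].
move=> /abs_summable_posneg[r [s [r0 s0 rf sf ->]]].
rewrite [RHS]mulrC !rsumB//.
have -> : (fun t : X * Y => (p t.1 - q t.1) * (r t.2 - s t.2)) =
    (fun t => (p t.1 * r t.2 + q t.1 * s t.2) -
              (p t.1 * s t.2 + q t.1 * r t.2)) by apply/funext => t; ring.
have E (u v : X -> K) (w z : Y -> K) :
    (forall x, 0 <= u x) -> (forall x, 0 <= v x) ->
    (forall y, 0 <= w y) -> (forall y, 0 <= z y) ->
    (psum u < +oo)%E -> (psum v < +oo)%E ->
    (psum w < +oo)%E -> (psum z < +oo)%E ->
    psum (fun t : X * Y => u t.1 * w t.2 + v t.1 * z t.2) =
    (fine (psum w) * fine (psum u) + fine (psum z) * fine (psum v))%:E.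
  move=> u0 v0 w0 z0 uf vf wf zf.
  rewrite psumD; [|by move=> t; rewrite mulr_ge0..].
  rewrite !psum_tens// (psum_fin u0)// (psum_fin v0)// (psum_fin w0)//.
  by rewrite (psum_fin z0).
rewrite rsumB ?E ?ltry//=; first by ring.
- by move=> t; rewrite addr_ge0 ?mulr_ge0.
- by move=> t; rewrite addr_ge0 ?mulr_ge0.
Qed.

Lemma abs_summable_tens (X Y : choiceType) (a : X -> K) (b : Y -> K) :
  abs_summable a -> abs_summable b ->
  abs_summable (fun p : X * Y => a p.1 * b p.2).
Proof.
move=> ha hb; rewrite /abs_summable.
under [X in psum X]funext do rewrite normrM.
rewrite (@psum_tens _ _ (fun x => `|a x|) (fun y => `|b y|))//.
by rewrite (psum_fin _ ha)// (psum_fin _ hb)// -EFinM ltry.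
Qed.

Lemma rsum_single (X : choiceType) (x : X) (a : X -> K) :
  (forall y, y != x -> a y = 0) -> rsum a = a x.
Proof.
move=> a0.
have E (b : X -> K) : (forall y, 0 <= b y) -> (forall y, y != x -> b y = 0) ->
    psum b = (b x)%:E.
  move=> b0 bx; rewrite /psum (esumID [set x]); last first.
    by move=> y _; rewrite lee_fin.
  rewrite setTI esum_set1 ?lee_fin// esum1 ?adde0// => y [_ /eqP].
  by move=> /bx ->.
rewrite /rsum !E /=.
- by case: (leP (a x) 0); case: (leP (- a x) 0); lra.
- by move=> y; rewrite le_max lexx orbT.
- by move=> y /a0 ->; rewrite oppr0 maxxx.
- by move=> y; rewrite le_max lexx orbT.
- by move=> y /a0 ->; rewrite maxxx.
Qed.

End Sums.

Section L2.
Context {K : realType} {X : choiceType}.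

Definition sqsum (f : X -> K[i]) : \bar K := psum (fun x => normc (f x) ^+ 2).

Definition l2_pred : {pred X -> K[i]} := [pred f | `[< (sqsum f < +oo)%E >]].

Lemma l2_predP (f : X -> K[i]) : reflect (sqsum f < +oo)%E (f \in l2_pred).
Proof. exact: asboolP. Qed.

Lemma normcE (z : K[i]) :
  normc z ^+ 2 = complex.Re z ^+ 2 + complex.Im z ^+ 2.
Proof. by case: z => a b; rewrite sqr_sqrtr // addr_ge0 ?sqr_ge0. Qed.

Lemma normc_parallel (a z w : K[i]) :
  normc (a * z + w) ^+ 2 <= 2 * normc a ^+ 2 * normc z ^+ 2 + 2 * normc w ^+ 2.
Proof.
rewrite -mulrA -exprMn -normcM.
move: (a * z) => {a}z; rewrite !normcE.
case: z w => [z1 z2] [w1 w2] /=.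
by have := sqr_ge0 (z1 - w1); have := sqr_ge0 (z2 - w2); nra.
Qed.

Fact l2_submod_closed : submod_closed l2_pred.
Proof.
split=> [|a f g].
  by apply/l2_predP; rewrite /sqsum /psum esum1 ?ltry // => x _;
    rewrite normc0 expr0n.
move=> /l2_predP hf /l2_predP hg; apply/l2_predP.
have sq0 (h : X -> K[i]) x : 0 <= normc (h x) ^+ 2 by exact: sqr_ge0.
apply: (@le_lt_trans _ _ ((2 * normc a ^+ 2)%:E * sqsum f + 2%:E * sqsum g)%E).
  have a0 : 0 <= 2 * normc a ^+ 2 by rewrite mulr_ge0 ?sqr_ge0.
  rewrite /sqsum -!psumZ // -psumD.
  - by apply: le_psum => x; apply: normc_parallel.
  - by move=> x; rewrite mulr_ge0.
  - by move=> x; rewrite mulr_ge0.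
rewrite /sqsum (psum_fin (sq0 f) hf) (psum_fin (sq0 g) hg).
by rewrite -!EFinM -EFinD ltry.
Qed.
HB.instance Definition _ :=
  GRing.isSubmodClosed.Build K[i] (X -> K[i]) l2_pred l2_submod_closed.

End L2.

Record l2 (K : realType) (X : choiceType) : Type :=
  L2 { l2_fun :> X -> K[i]; l2_funP : l2_fun \in l2_pred }.

HB.instance Definition _ K X := [isSub of l2 K X for @l2_fun K X].
HB.instance Definition _ K X := [Choice of l2 K X by <:].
HB.instance Definition _ K X := [SubChoice_isSubLmodule of l2 K X by <:].

Section Hilbert.
Context {K : realType}.

Definition l2norm (X : choiceType) (f : l2 K X) : K :=
  Num.sqrt (fine (sqsum f)).

Definition dot (X : choiceType) (f g : l2 K X) : K[i] :=
  csum (fun x => f x * conjc (g x)).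

Fact delta_subproof (X : choiceType) (x : X) :
  (fun y => (y == x)%:R : K[i]) \in l2_pred.
Proof.
apply/l2_predP; rewrite /sqsum /psum (esumID [set x]); last first.
  by move=> y _; rewrite lee_fin sqr_ge0.
rewrite setTI esum_set1 ?lee_fin ?sqr_ge0// esum1 ?adde0 ?ltry// => y [_ /eqP].
by move=> /negPf ->; rewrite normc0 expr0n.
Qed.

Definition delta (X : choiceType) (x : X) : l2 K X := L2 (delta_subproof x).

Fact tens_subproof (X Y : choiceType) (f : l2 K X) (g : l2 K Y) :
  (fun p : X * Y => f p.1 * g p.2) \in l2_pred.
Proof.
have sq0 (Z : choiceType) (h : l2 K Z) z : 0 <= normc (h z) ^+ 2.
  exact: sqr_ge0.
have /l2_predP hf := l2_funP f; have /l2_predP hg := l2_funP g.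
apply/l2_predP; rewrite /sqsum.
under [X in psum X]funext do rewrite normcM exprMn.
rewrite (psum_tens (sq0 _ f) (sq0 _ g))//.
by rewrite (psum_fin (sq0 _ f))// (psum_fin (sq0 _ g))// -EFinM ltry.
Qed.

(* [l2 K (X * Y)], with the bilinear map [tens], is the Hilbert space tensor
   product of [l2 K X] and [l2 K Y]: [tens] is multiplicative on inner products
   ([dot_tens]) and the elementary tensors of basis vectors form the standard
   orthonormal basis of [l2 K (X * Y)] ([tens_delta], [dot_delta]). *)
Definition tens (X Y : choiceType) (f : l2 K X) (g : l2 K Y) : l2 K (X * Y)%type :=
  L2 (tens_subproof f g).

Lemma tens_delta (X Y : choiceType) (x : X) (y : Y) :
  tens (delta x) (delta y) = delta (x, y).
Proof.
apply/val_inj/funext => -[x' y'] /=.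
by rewrite xpair_eqE; case: eqP; case: eqP; rewrite ?mulr1 ?mulr0.
Qed.

Lemma l2_dot_summable (X : choiceType) (f g : l2 K X) (h : K[i] -> K) :
  (forall z, `|h z| <= normc z) -> abs_summable (fun x => h (f x * conjc (g x))).
Proof.
move=> hh.
have /l2_predP hf := l2_funP f; have /l2_predP hg := l2_funP g.
apply: le_lt_trans (lte_add_pinfty hf hg); rewrite /sqsum -psumD.
- apply: le_psum => x; apply: le_trans (hh _) _.
  rewrite normcM [normc (conjc _)](_ : _ = normc (g x)); last first.
    by case: (g x) => a b; rewrite /= sqrrN.
  move: (normc (f x)) (normc (g x)) => a b.
  by have := sqr_ge0 (a - b); have := sqr_ge0 (a + b); nra.
- by move=> x; exact: sqr_ge0.
- by move=> x; exact: sqr_ge0.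
Qed.

Lemma ler_norm_Re (z : K[i]) : `|complex.Re z| <= normc z.
Proof.
by case: z => a b /=; rewrite -sqrtr_sqr ler_sqrt ?lerDl ?addr_ge0 ?sqr_ge0.
Qed.

Lemma ler_norm_Im (z : K[i]) : `|complex.Im z| <= normc z.
Proof.
by case: z => a b /=; rewrite -sqrtr_sqr ler_sqrt ?lerDr ?addr_ge0 ?sqr_ge0.
Qed.

Lemma dot_tens (X Y : choiceType) (f f' : l2 K X) (g g' : l2 K Y) :
  dot (tens f g) (tens f' g') = dot f f' * dot g g'.
Proof.
have hRe (Z : choiceType) (u v : l2 K Z) := l2_dot_summable u v ler_norm_Re.
have hIm (Z : choiceType) (u v : l2 K Z) := l2_dot_summable u v ler_norm_Im.
have nS (Z : choiceType) (a : Z -> K) : abs_summable a ->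
    abs_summable (fun z => - a z).
  by move=> ha; rewrite /abs_summable; under [X in psum X]funext do rewrite normrN.
have cM (a b c d : K) : (a +i* b)%C * (c +i* d)%C =
    ((a * c - b * d) +i* (a * d + b * c))%C by [].
rewrite /dot /csum cM -!rsum_tens// -rsumN -!rsumD//.
- congr (_ +i* _)%C; congr rsum; apply/funext => -[x y] /=;
    case: (f x) (f' x) (g y) (g' y) => [? ?] [? ?] [? ?] [? ?] /=; ring.
- exact: (abs_summable_tens (hRe _ f f') (hIm _ g g')).
- exact: (abs_summable_tens (hIm _ f f') (hRe _ g g')).
- exact: (abs_summable_tens (hRe _ f f') (hRe _ g g')).
- exact/nS/(abs_summable_tens (hIm _ f f') (hIm _ g g')).
Qed.

Lemma dot_delta (X : choiceType) (f : l2 K X) (x : X) : dot f (delta x) = f x.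
Proof.
rewrite /dot /csum /= !(@rsum_single _ _ x) => [|y /negPf->|y /negPf->] /=.
- by rewrite eqxx; case: (f x) => a b /=; congr (_ +i* _)%C; ring.
- by case: (f y) => a b /=; ring.
- by case: (f y) => a b /=; ring.
Qed.

Lemma dot_l2norm (X : choiceType) (f : l2 K X) :
  dot f f = ((l2norm f ^+ 2)%:C)%C.
Proof.
have f0 x : 0 <= normc (f x) ^+ 2 by exact: sqr_ge0.
rewrite sqr_sqrtr; last by apply/fine_ge0/psum_ge0.
rewrite /dot /csum; congr (_ +i* _)%C.
  have -> : (fun x => complex.Re (f x * conjc (f x))) =
      (fun x => normc (f x) ^+ 2 - 0).
    by apply/funext => x; rewrite normcE; case: (f x) => a b /=; ring.
  have z0 : psum (fun _ : X => 0 : K) = 0%E by rewrite /psum esum1.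
  rewrite rsumB// ?z0 ?ltry//= ?subr0//.
  by have /l2_predP := l2_funP f.
have -> : (fun x => complex.Im (f x * conjc (f x))) = (fun=> 0).
  by apply/funext => x; case: (f x) => a b /=; ring.
by rewrite /rsum oppr0 maxxx subrr.
Qed.

End Hilbert.

Section Operators.
Context {K : realType}.
Implicit Types X Y : choiceType.

Definition bounded_op X : set (l2 K X -> l2 K X) :=
  [set T | linear T /\ exists c : K, forall f, l2norm (T f) <= c * l2norm f].

Definition opnorm X (T : l2 K X -> l2 K X) : K :=
  sup [set l2norm (T f) | f in [set f | l2norm f <= 1]].

(* [adjoint_op T T'] says that [T' = T^*] in B(l2 X). *)
Definition adjoint_op X (T T' : l2 K X -> l2 K X) : Prop :=
  [/\ bounded_op T, bounded_op T' & forall f g, dot (T f) g = dot f (T' g)].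

Definition isometry_op X (T : l2 K X -> l2 K X) : Prop :=
  bounded_op T /\ forall f, l2norm (T f) = l2norm f.

Definition unitary_op X (T : l2 K X -> l2 K X) : Prop :=
  exists T', [/\ adjoint_op T T', T' \o T = id & T \o T' = id].

Definition unitary_rep X (G : zmodType) (pi : G -> l2 K X -> l2 K X) : Prop :=
  [/\ forall g, unitary_op (pi g), pi 0 = id &
      forall g h, pi (g + h) = pi g \o pi h].

Record is_cstar_subalgebra X (A : set (l2 K X -> l2 K X)) : Prop := {
  cstar_bounded : A `<=` @bounded_op X;
  cstar_zero : A (fun=> 0);
  cstar_add : forall S T, A S -> A T -> A (fun f => S f + T f);
  cstar_scale : forall (c : K[i]) T, A T -> A (fun f => c *: T f);
  cstar_mul : forall S T, A S -> A T -> A (S \o T);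
  cstar_adjoint : forall T T', A T -> adjoint_op T T' -> A T';
  cstar_closed : forall T, bounded_op T ->
    (forall e : K, 0 < e -> exists2 S, A S & opnorm (fun f => T f - S f) < e) ->
    A T
}.

Definition cstar_gen X (G : set (l2 K X -> l2 K X)) : set (l2 K X -> l2 K X) :=
  smallest (@is_cstar_subalgebra X) G.

(* Isomorphism of C*-algebras, i.e. bijective *-homomorphism. *)
Definition cstar_iso X Y
    (A : set (l2 K X -> l2 K X)) (B : set (l2 K Y -> l2 K Y)) : Prop :=
  exists phi : (l2 K X -> l2 K X) -> (l2 K Y -> l2 K Y),
  [/\ set_bij A B phi,
      forall S T, A S -> A T -> phi (fun f => S f + T f) =
                                (fun g => phi S g + phi T g),
      forall (c : K[i]) T, A T -> phi (fun f => c *: T f) =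
                                  (fun g => c *: phi T g),
      forall S T, A S -> A T -> phi (S \o T) = phi S \o phi T &
      forall T T', A T -> adjoint_op T T' -> adjoint_op (phi T) (phi T')].

End Operators.

Section ReducedGroupAlgebra.
Context {K : realType} {G : zmodType}.

Fact left_regular_subproof (g : G) (f : l2 K G) :
  (fun h => f (h - g)) \in l2_pred.
Proof.
have /l2_predP hf := l2_funP f; apply/l2_predP; rewrite /sqsum /psum.
rewrite -(@reindex_esum _ _ _ [set: G] [set: G] (fun h => h - g)
  (fun h => (normc (f h) ^+ 2)%:E))//.
by split=> // [x y _ _ /addIr //|y _]; exists (y + g); rewrite ?addrK.
Qed.

Definition left_regular (g : G) (f : l2 K G) : l2 K G :=
  L2 (left_regular_subproof g f).

Lemma left_regular_delta (g h : G) :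
  left_regular g (delta h) = delta (g + h).
Proof.
by apply/val_inj/funext => k /=; rewrite subr_eq addrC.
Qed.

Definition reduced_cstar : set (l2 K G -> l2 K G) := cstar_gen (range left_regular).

End ReducedGroupAlgebra.
Arguments reduced_cstar K G : clear implicits.

Section NonzeroElements.
Context {R : idomainType}.

Definition nonzero : Type := {r : R | r != 0}.
HB.instance Definition _ := SubChoice.on nonzero.

Implicit Types r s : nonzero.

Definition nz_one : nonzero := exist _ 1 (oner_neq0 R).

Definition nz_mul r s : nonzero :=
  exist _ (val r * val s) (mulf_neq0 (valP r) (valP s)).

Definition nz_add r s (rs0 : val r + val s != 0) : nonzero :=
  exist _ (val r + val s) rs0.

Fact nz_inv_subproof r : (val r)^-1 != 0.
Proof. by rewrite invr_eq0 (valP r). Qed.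

(* Only meaningful when [val r] is a unit: [x^-1 = x] otherwise. *)
Definition nz_inv r : nonzero := exist _ (val r)^-1 (nz_inv_subproof r).

End NonzeroElements.
Arguments nonzero R : clear implicits.

Section Families.
Context {K : realType} {R : idomainType} {M : lmodType R}.
Local Notation H := (l2 K (M * nonzero R)%type).

Definition translation_ops (U : M -> H -> H) : Prop :=
  forall m, bounded_op (U m) /\
  forall (n : M) (s : nonzero R),
    U m (tens (delta n) (delta s)) = tens (delta (val s *: m + n)) (delta s).

Definition multiplication_ops (S : nonzero R -> H -> H) : Prop :=
  forall r, bounded_op (S r) /\
  forall (n : M) (s : nonzero R),
    S r (tens (delta n) (delta s)) = tens (delta n) (delta (nz_mul r s)).

End Families.

(* Main.v *)
(* The point is (3). Write pi(a) for the operator attached by a unitary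
   representation pi to a finitely supported a in C[M], and lambda for the
   regular representation. Restricting to the fibre s = 1 turns U(a) into
   lambda(a), so |lambda(a)| <= |U(a)|. Conversely |pi(a)| <= |lambda(a)| for
   every unitary representation pi of an abelian group: for b = a^* a and
   n = 2^j, the coefficients of b^n are bounded by |lambda(b^n)| and b^n has at
   most (n + 1)^k of them, k being the number of terms of b, whence
   |pi(b)|^n <= (n + 1)^k |lambda(b)|^n; let j tend to infinity. Thus
   compression to the fibre s = 1 is isometric on the norm closure of
   {U(a)}, which is C^*(mu(M)), and maps it onto the closure of {lambda(a)}. *)
From HB Require Import structures.
Require Import Defs.
From mathcomp Require Import all_boot all_order all_algebra.
From mathcomp Require Import all_classical all_reals all_analysis.
From mathcomp Require Import complex ring lra.

Set Implicit Arguments.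
Unset Strict Implicit.
Unset Printing Implicit Defensive.

Import Order.TTheory GRing.Theory Num.Theory.
Import ComplexField.Normc.
Local Open Scope classical_set_scope.
Local Open Scope ring_scope.

(** On the fibre over [s] the operator [U^m] is translation by [s m], so [U] is the direct sum over
    [s] of the regular representation composed with [m -> s m]. When [M] has torsion, multiplication
    by [s] may have a kernel; the other fibres are then not copies of the regular representation,
    and nothing formal bounds their norms by that of the fibre [s = 1]. The bound is a form of
    amenability, and the growth argument obtains it without characters or a Fourier transform. Only
    exponents [2^j] occur because the identity [|x^* x| = |x|^2] gives the exact norm of the square
    of a self-adjoint element, and repeated squaring reaches just these. Surjectivity of the
    compression needs limits of operators, hence a completeness proof with explicit rates. The
    remaining claims live on the index set: [U^m] and [S_r] map basis vectors injectively to basis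
    vectors, so each relation is an identity between maps of indices. *)

Section ComplexModulus.
Context {K : realType}.
Implicit Types z w : K[i].

Lemma normc_ge0 z : 0 <= normc z.
Proof. by case: z => a b; exact: sqrtr_ge0. Qed.

Lemma normcN z : normc (- z) = normc z.
Proof. by case: z => a b /=; rewrite !sqrrN. Qed.

Lemma normc_real (a : K) : 0 <= a -> normc (a%:C)%C = a.
Proof. by move=> a0; rewrite /normc/= expr0n addr0 sqrtr_sqr ger0_norm. Qed.

Lemma normc_le_ReIm z : normc z <= `|complex.Re z| + `|complex.Im z|.
Proof.
rewrite -(@ler_pXn2r _ 2) ?nnegrE ?normc_ge0 ?addr_ge0// Defs.normcE sqrrD.
by rewrite !real_normK ?num_real// lerD2r lerDl mulrn_wge0 ?mulr_ge0.
Qed.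

End ComplexModulus.

(** * Finite partial sums and reindexing of unordered sums *)

Section SumBounds.
Context {K : realType} {X : choiceType}.
Implicit Types a b : X -> K.

Lemma psum_ge a (s : seq X) : uniq s -> ((\sum_(x <- s) a x)%:E <= psum a)%E.
Proof.
move=> us; apply: esum_ge; exists [set` s].
  by split => //; exact: finite_set_seq.
by rewrite -fsbig_seq// -sumEFin.
Qed.

Lemma psum_le a (c : K) :
  (forall s : seq X, uniq s -> \sum_(x <- s) a x <= c) -> (psum a <= c%:E)%E.
Proof.
move=> h; apply: ge_ereal_sup => _ [A [fA _] <-].
rewrite fsbig_finite//= sumEFin lee_fin; apply: h.
exact: finmap.fset_uniq.
Qed.

Lemma psum_approx a (e : K) : (forall x, 0 <= a x) -> (psum a < +oo)%E -> 0 < e ->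
  exists2 s : seq X, uniq s & fine (psum a) - e < \sum_(x <- s) a x.
Proof.
move=> a0 aoo e0.
have : ((fine (psum a) - e)%:E < psum a)%E.
  by rewrite {2}(psum_fin a0 aoo) lte_fin; lra.
move=> /ereal_sup_gt[_ [A [fA _] <-]].
rewrite fsbig_finite//= sumEFin lte_fin => h.
by exists (finmap.enum_fset (fset_set A)) => //; exact: finmap.fset_uniq.
Qed.

End SumBounds.

Lemma psum_inj (K : realType) (X Y : choiceType) (i : X -> Y) (a : Y -> K) :
  injective i -> (forall y, 0 <= a y) -> (forall y, ~ range i y -> a y = 0) ->
  psum a = psum (a \o i).
Proof.
move=> ii a0 ai; rewrite /psum (esumID (range i)); last first.
  by move=> y _; rewrite lee_fin.
rewrite setTI [X in (_ + X)%E]esum1 ?adde0; last by move=> y [_ /ai ->].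
rewrite (@reindex_esum _ _ _ [set: X] (range i) i)//; split => //.
by move=> x y _ _ /ii.
Qed.

Lemma rsum_inj (K : realType) (X Y : choiceType) (i : X -> Y) (a : Y -> K) :
  injective i -> (forall y, ~ range i y -> a y = 0) -> rsum a = rsum (a \o i).
Proof.
move=> ii ai; rewrite /rsum !(psum_inj ii)//.
- by move=> y; rewrite le_max lexx orbT.
- by move=> y /ai ->; rewrite oppr0 maxxx.
- by move=> y; rewrite le_max lexx orbT.
- by move=> y /ai ->; rewrite maxxx.
Qed.

(** [rsum] is built from positive and negative parts, which only a nonnegative scalar preserves; a
    negative [c] is reduced to [- c] by [rsumN]. *)
Lemma rsumZ (K : realType) (X : choiceType) (c : K) (a : X -> K) :
  abs_summable a -> rsum (fun x => c * a x) = c * rsum a.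
Proof.
wlog c0 : c / 0 <= c => [h ha|].
  have [/h|/ltW] := leP 0 c; first exact.
  rewrite -oppr_ge0 => /h /(_ ha) h'.
  rewrite -[c]opprK mulNr -h' -rsumN; congr rsum.
  by apply/funext => x; rewrite mulNr.
move=> /abs_summable_posneg[p [q [p0 q0 pf qf ->]]].
have -> : (fun x => c * (p x - q x)) = (fun x => c * p x - c * q x).
  by apply/funext => x; rewrite mulrBr.
have Z (b : X -> K) : (forall x, 0 <= b x) -> (psum b < +oo)%E ->
    [/\ forall x, 0 <= c * b x, (psum (fun x => (c * b x)%R) < +oo)%E &
        fine (psum (fun x => c * b x)) = c * fine (psum b)].
  move=> b0 bf; split; first by move=> x; rewrite mulr_ge0.
    by rewrite psumZ// (psum_fin b0 bf) -EFinM ltry.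
  by rewrite psumZ// (psum_fin b0 bf).
have [cp0 cpf cpE] := Z _ p0 pf; have [cq0 cqf cqE] := Z _ q0 qf.
by rewrite (rsumB cp0 cq0 cpf cqf) (rsumB p0 q0 pf qf) cpE cqE mulrBr.
Qed.

(** * The norm and the real inner product of [l2] *)

Section Norm.
Context {K : realType} {X : choiceType}.
Implicit Types (f g h : l2 K X) (c : K) (x : X).

Lemma l2P f g : (forall x, f x = g x) -> f = g.
Proof. by move=> h; apply/val_inj/funext. Qed.

Lemma l2D f g x : (f + g) x = f x + g x. Proof. by []. Qed.
Lemma l2N f x : (- f) x = - f x. Proof. by []. Qed.
Lemma l2Z (a : K[i]) f x : (a *: f) x = a * f x. Proof. by []. Qed.
Lemma l20 x : (0 : l2 K X) x = 0. Proof. by []. Qed.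

Lemma l2norm_ge0 f : 0 <= l2norm f. Proof. exact: sqrtr_ge0. Qed.

Lemma sqsum_l2norm f : sqsum f = ((l2norm f ^+ 2)%:E)%E.
Proof.
have f0 x : 0 <= normc (f x) ^+ 2 by exact: sqr_ge0.
rewrite sqr_sqrtr; last exact/fine_ge0/psum_ge0.
by apply: psum_fin => //; have /l2_predP := l2_funP f.
Qed.

Lemma sum_le_l2norm f (s : seq X) :
  uniq s -> \sum_(x <- s) normc (f x) ^+ 2 <= l2norm f ^+ 2.
Proof. by move=> us; rewrite -lee_fin -sqsum_l2norm psum_ge. Qed.

Lemma l2norm_le f c : 0 <= c ->
  (forall s, uniq s -> \sum_(x <- s) normc (f x) ^+ 2 <= c ^+ 2) -> l2norm f <= c.
Proof.
move=> c0 /psum_le; rewrite -[psum _]/(sqsum f) sqsum_l2norm lee_fin.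
by rewrite ler_pXn2r ?nnegrE ?l2norm_ge0.
Qed.

Lemma normc_le_l2norm f x : normc (f x) <= l2norm f.
Proof.
rewrite -(@ler_pXn2r _ 2) ?nnegrE ?normc_ge0 ?l2norm_ge0//.
by have := @sum_le_l2norm f [:: x] isT; rewrite big_seq1.
Qed.

Lemma l2norm_eq0 f : l2norm f <= 0 -> f = 0.
Proof.
move=> f0; apply: l2P => x; apply: eq0_normc; apply/eqP.
by rewrite eq_le normc_ge0 andbT (le_trans (normc_le_l2norm f x)).
Qed.

Lemma l2norm0 : l2norm (0 : l2 K X) = 0.
Proof.
by rewrite /l2norm /sqsum /psum esum1 ?sqrtr0// => x _; rewrite l20 normc0 expr0n.
Qed.

Lemma l2normZ (a : K[i]) f : l2norm (a *: f) = normc a * l2norm f.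
Proof.
apply/eqP; rewrite -(@eqrXn2 _ 2) ?mulr_ge0 ?normc_ge0 ?l2norm_ge0//.
rewrite -eqe -sqsum_l2norm exprMn EFinM -sqsum_l2norm /sqsum -psumZ ?sqr_ge0//.
  by apply/eqP; congr psum; apply/funext => x; rewrite l2Z normcM exprMn.
by move=> x; rewrite sqr_ge0.
Qed.

Lemma l2normN f : l2norm (- f) = l2norm f.
Proof. by rewrite -scaleN1r l2normZ normcN normc1 mul1r. Qed.

Lemma l2norm_delta x : l2norm (delta x : l2 K X) = 1.
Proof.
apply/eqP; rewrite -(@eqrXn2 _ 2) ?l2norm_ge0//; apply/eqP.
have : dot (delta x : l2 K X) (delta x) = 1 by rewrite dot_delta /= eqxx.
by rewrite dot_l2norm => -[->]; rewrite expr1n.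
Qed.

(** The real part is enough for the triangle inequality: [|f + g|^2] involves the inner product of
    [f] and [g] only through it. *)
Definition rdot f g : K := complex.Re (dot f g).

Lemma rdotDl f g h : rdot (f + g) h = rdot f h + rdot g h.
Proof.
rewrite /rdot /dot /= -rsumD; first last.
- exact: l2_dot_summable ler_norm_Re.
- exact: l2_dot_summable ler_norm_Re.
by congr rsum; apply/funext => x; rewrite mulrDl raddfD.
Qed.

Lemma rdotZl c f h : rdot ((c%:C)%C *: f) h = c * rdot f h.
Proof.
rewrite /rdot /dot /= -rsumZ; last exact: l2_dot_summable ler_norm_Re.
congr rsum; apply/funext => x.
rewrite -[LHS]/(complex.Re ((c%:C)%C * f x * conjc (h x))).
by case: (f x) => a b; case: (h x) => a' b' /=; ring.
Qed.

Lemma rdotC f g : rdot f g = rdot g f.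
Proof.
rewrite /rdot /dot /=; congr rsum; apply/funext => x.
by case: (f x) => a b; case: (g x) => a' b' /=; ring.
Qed.

Lemma rdot_l2norm f : rdot f f = l2norm f ^+ 2.
Proof. by rewrite /rdot dot_l2norm. Qed.

Lemma rdot0l f : rdot 0 f = 0.
Proof. by rewrite -(scale0r 0) (rdotZl 0) mul0r. Qed.

Lemma rdot_le f g : rdot f g <= l2norm f * l2norm g.
Proof.
have [->|f0] := eqVneq f 0; first by rewrite rdot0l mulr_ge0 ?l2norm_ge0.
have [->|g0] := eqVneq g 0; first by rewrite rdotC rdot0l mulr_ge0 ?l2norm_ge0.
have pos h : h != 0 -> 0 < l2norm h.
  by rewrite ltNge; apply: contra => /l2norm_eq0 ->.
pose u := l2norm g; pose v := l2norm f.
have u0 : 0 < u := pos _ g0; have v0 : 0 < v := pos _ f0.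
(* The square expands to [2 u v (u v - rdot f g)], and [u v > 0] can be divided out. *)
have := sqr_ge0 (l2norm ((u%:C)%C *: f + ((- v)%:C)%C *: g)).
rewrite -rdot_l2norm rdotDl !rdotZl ![rdot _ (_ + _)]rdotC !rdotDl !rdotZl.
rewrite !rdot_l2norm -/u -/v (rdotC g f) => h.
rewrite -subr_ge0 -(pmulr_rge0 _ (mulr_gt0 u0 v0)).
by move: h; nra.
Qed.

Lemma l2normD f g : l2norm (f + g) <= l2norm f + l2norm g.
Proof.
rewrite -(@ler_pXn2r _ 2) ?nnegrE ?addr_ge0 ?l2norm_ge0//.
rewrite -rdot_l2norm rdotDl ![rdot _ (_ + _)]rdotC !rdotDl !rdot_l2norm.
by have := rdot_le f g; rewrite (rdotC g f); lra.
Qed.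

Lemma l2normB f g : l2norm (f - g) <= l2norm f + l2norm g.
Proof. by rewrite -(l2normN g) l2normD. Qed.

Lemma l2norm_sum (I : Type) (s : seq I) (F : I -> l2 K X) :
  l2norm (\sum_(i <- s) F i) <= \sum_(i <- s) l2norm (F i).
Proof.
elim/big_rec2: _ => [|i x y _ h]; first by rewrite l2norm0.
exact: le_trans (l2normD _ _) (lerD (lexx _) h).
Qed.

End Norm.

(** * Bounded operators *)

Section BoundedMaps.
Context {K : realType}.
Implicit Types (X Y Z : choiceType) (c : K).

Definition op_bound X Y c (T : l2 K X -> l2 K Y) : Prop :=
  forall f, l2norm (T f) <= c * l2norm f.

(** [bounded_op] carries linearity as a proposition; packing it as a structure gives access to the
    rewriting rules for linear maps. *)
Lemma linear_pack X Y (T : l2 K X -> l2 K Y) :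
  linear T -> exists L : {linear l2 K X -> l2 K Y}, T = L.
Proof.
move=> lT.
pose m := GRing.isLinear.Build K[i] (l2 K X) (l2 K Y) *:%R T lT.
pose L : {linear l2 K X -> l2 K Y} := HB.pack T m.
by exists L.
Qed.

Lemma bounded_op_linear X (T : l2 K X -> l2 K X) : bounded_op T ->
  exists2 L : {linear l2 K X -> l2 K X}, T = L & exists2 c, 0 <= c & op_bound c L.
Proof.
move=> [/linear_pack[L ->] [c hc]]; exists L => //; exists `|c| => // f.
by rewrite (le_trans (hc f))// ler_wpM2r ?l2norm_ge0 ?ler_norm.
Qed.

Lemma op_bound_opnorm X (T : l2 K X -> l2 K X) :
  bounded_op T -> op_bound (opnorm T) T.
Proof.
move=> /bounded_op_linear[L -> [c c0 hc]] f.
have [->|f0] := eqVneq f 0; first by rewrite linear0 l2norm0 mulr0.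
have {}f0 : 0 < l2norm f.
  by rewrite ltNge; apply: contra f0 => /l2norm_eq0 ->.
have fi : 0 <= (l2norm f)^-1 by rewrite invr_ge0 ltW.
rewrite -ler_pdivrMr//; apply: sup_upper_bound.
  split; first by exists (l2norm (L 0)), 0 => //=; rewrite l2norm0.
  exists c => _ [g /= g1 <-]; apply: le_trans (hc g) _.
  by rewrite ler_piMr.
exists (((l2norm f)^-1%:C)%C *: f) => /=.
  by rewrite l2normZ normc_real// mulVf// gt_eqF.
by rewrite linearZ l2normZ normc_real// mulrC.
Qed.

Lemma opnorm_le X (T : l2 K X -> l2 K X) c :
  0 <= c -> op_bound c T -> opnorm T <= c.
Proof.
move=> c0 hc; apply: ge_sup.
  by exists (l2norm (T 0)), 0 => //=; rewrite l2norm0.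
by move=> _ [f /= f1 <-]; apply: le_trans (hc f) _; rewrite ler_piMr.
Qed.

Lemma opnorm_ge0 X (T : l2 K X -> l2 K X) : bounded_op T -> 0 <= opnorm T.
Proof.
move=> bT; have [_ [c hc]] := bT; apply: (@le_trans _ _ (l2norm (T 0))).
  exact: l2norm_ge0.
apply: sup_upper_bound; last by exists 0 => //=; rewrite l2norm0.
split; first by exists (l2norm (T 0)), 0 => //=; rewrite l2norm0.
exists `|c| => _ [f /= f1 <-]; apply: le_trans (hc f) _.
apply: (@le_trans _ _ (`|c| * l2norm f)).
  by rewrite ler_wpM2r ?l2norm_ge0 ?ler_norm.
by rewrite ler_piMr.
Qed.

Lemma bounded_opD X (S T : l2 K X -> l2 K X) :
  bounded_op S -> bounded_op T -> bounded_op (fun f => S f + T f).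
Proof.
move=> /bounded_op_linear[L -> [c c0 hc]] /bounded_op_linear[N -> [d d0 hd]].
split=> [a f g|]; first by rewrite !linearP scalerDr addrACA.
exists (c + d) => f; rewrite mulrDl; apply: le_trans (l2normD _ _) _.
exact: lerD.
Qed.

Lemma bounded_opZ X (a : K[i]) (T : l2 K X -> l2 K X) :
  bounded_op T -> bounded_op (fun f => a *: T f).
Proof.
move=> /bounded_op_linear[L -> [c c0 hc]].
split=> [b f g|]; first by rewrite linearP scalerDr !scalerA mulrC.
exists (normc a * c) => f.
by rewrite l2normZ -mulrA ler_wpM2l ?normc_ge0.
Qed.

Lemma bounded_op_comp X (S T : l2 K X -> l2 K X) :
  bounded_op S -> bounded_op T -> bounded_op (S \o T).
Proof.
move=> /bounded_op_linear[L -> [c c0 hc]] /bounded_op_linear[N -> [d d0 hd]].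
split=> [a f g|]; first by rewrite /= !linearP.
exists (c * d) => f; apply: le_trans (hc _) _.
by rewrite -mulrA ler_wpM2l.
Qed.

Lemma bounded_op0 X : bounded_op (fun _ : l2 K X => 0 : l2 K X).
Proof.
split=> [a f g|]; first by rewrite scaler0 addr0.
by exists 0 => f; rewrite l2norm0 mul0r.
Qed.

Lemma bounded_opB X (S T : l2 K X -> l2 K X) :
  bounded_op S -> bounded_op T -> bounded_op (fun f => S f - T f).
Proof.
move=> bS bT; have := bounded_opD bS (bounded_opZ (-1) bT).
by congr bounded_op; apply/funext => f; rewrite scaleN1r.
Qed.

Lemma bounded_op_id X : bounded_op (@id (l2 K X)).
Proof. by split=> //; exists 1 => f; rewrite mul1r. Qed.

Lemma finite_truncation X (f : l2 K X) c : 0 < c ->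
  exists2 s : seq X, uniq s & l2norm (f - \sum_(x <- s) f x *: delta x) <= c.
Proof.
move=> c0; have sq0 x : 0 <= normc (f x) ^+ 2 by exact: sqr_ge0.
have /l2_predP fin := l2_funP f.
have [s us hs] := psum_approx sq0 fin (exprn_gt0 2 c0).
exists s => //; apply: l2norm_le => [|t ut]; first exact: ltW.
have sumE (r : seq X) y : uniq r -> (\sum_(x <- r) f x *: delta x : l2 K X) y =
    if y \in r then f y else 0.
  elim: r => [_|x r IH /= /andP[xr ur]]; first by rewrite big_nil.
  rewrite big_cons l2D l2Z IH//= in_cons.
  have [->|_] /= := eqVneq y x; first by rewrite (negPf xr) mulr1 addr0.
  by rewrite mulr0 add0r.
have -> : \sum_(x <- t) normc ((f - \sum_(x <- s) f x *: delta x) x) ^+ 2 =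
    \sum_(x <- t | x \notin s) normc (f x) ^+ 2.
  rewrite [RHS]big_mkcond; apply: eq_bigr => x _.
  rewrite l2D l2N sumE//.
  by case: ifP => /= _; [rewrite subrr normc0 expr0n|rewrite subr0].
(* The entries of [t] outside [s] prolong [s] without repetition, so their mass is at most the total
   minus the mass on [s], which is below [c ^ 2]. *)
have ust : uniq (s ++ [seq x <- t | x \notin s]).
  rewrite cat_uniq us filter_uniq// andbT /=.
  by apply/hasPn => x; rewrite mem_filter => /andP[].
have := psum_ge (fun x => normc (f x) ^+ 2) ust.
rewrite (psum_fin sq0 fin) lee_fin big_cat/= big_filter.
by move: hs; set a := fine _; set b := \sum_(_ <- s) _ => hs; lra.
Qed.

(** Finitely supported vectors are dense, and a bounded difference vanishing on them is zero. This
    is the sense in which formulas on basis vectors determine an operator. *)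
Lemma eq_bounded_op X (S T : l2 K X -> l2 K X) :
  bounded_op S -> bounded_op T -> (forall x, S (delta x) = T (delta x)) -> S = T.
Proof.
move=> bS bT ST; apply/funext => f; apply/eqP; rewrite -subr_eq0; apply/eqP.
apply: l2norm_eq0; have [L LE [c c0 hc]] := bounded_op_linear (bounded_opB bS bT).
rewrite -[_ - _]/((fun f => S f - T f) f) LE.
apply/ler_addgt0Pr => e e0; rewrite add0r.
(* The bound [c] may be zero, hence the tolerance [e / (c + 1)]. *)
have c10 : 0 < c + 1 by rewrite ltr_wpDl.
have [s us hs] := finite_truncation f (divr_gt0 e0 c10).
have -> : L f = L (f - \sum_(x <- s) f x *: delta x).
  rewrite linearB linear_sum big1 ?subr0// => x _.
  by rewrite linearZ/= -LE ST subrr scaler0.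
apply: le_trans (hc _) _; apply: (@le_trans _ _ ((c + 1) * (e / (c + 1)))).
  by rewrite ler_pM ?l2norm_ge0// lerDl.
by rewrite mulrC divfK ?gt_eqF.
Qed.

End BoundedMaps.

(** * Operators induced by injections of the index set *)

Lemma csum_inj (K : realType) (X Y : choiceType) (i : X -> Y) (F : Y -> K[i]) :
  injective i -> (forall y, ~ range i y -> F y = 0) -> csum F = csum (F \o i).
Proof.
by move=> ii Fi; rewrite /csum; congr (_ +i* _)%C; apply: rsum_inj => // y /Fi ->.
Qed.

Section PushPull.
Context {K : realType} {X Y : choiceType} (i : X -> Y) (ii : injective i).
Implicit Types (f : l2 K X) (g : l2 K Y).

(** Extension by zero off the range of [i], with [cid] inverting [i] on it. On [l2] this becomes the
    isometry sending [delta x] to [delta (i x)]; its adjoint is composition with [i]. *)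
Definition push_fun (f : X -> K[i]) (y : Y) : K[i] :=
  if pselect (exists x, i x = y) is left h then f (projT1 (cid h)) else 0.

Lemma push_fun_im (f : X -> K[i]) x : push_fun f (i x) = f x.
Proof.
rewrite /push_fun; case: pselect => [h|[]]; last by exists x.
by case: cid => z /= /ii ->.
Qed.

Lemma push_fun_out (f : X -> K[i]) y : ~ range i y -> push_fun f y = 0.
Proof.
rewrite /push_fun; case: pselect => // -[x xy] []; by exists x.
Qed.

Lemma sqsum_inj (h : Y -> K[i]) : (forall y, ~ range i y -> h y = 0) ->
  sqsum h = sqsum (h \o i).
Proof.
move=> h0; apply: (psum_inj ii) => [y|y /h0 ->]; first exact: sqr_ge0.
by rewrite normc0 expr0n.
Qed.

Lemma sqsum_push (f : X -> K[i]) : sqsum (push_fun f) = sqsum f.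
Proof.
rewrite sqsum_inj; last exact: push_fun_out.
by congr sqsum; apply/funext => x /=; rewrite push_fun_im.
Qed.

Fact push_subproof f : push_fun f \in l2_pred.
Proof. by apply/l2_predP; rewrite sqsum_push; apply/l2_predP; exact: l2_funP. Qed.

Definition push f : l2 K Y := L2 (push_subproof f).

(** Pushing [g \o i] forward again gives [g] cut off outside the range of [i], so the comparison can
    be made pointwise on [Y]. *)
Lemma sqsum_pull (g : Y -> K[i]) : (sqsum (g \o i) <= sqsum g)%E.
Proof.
rewrite -sqsum_push; apply: le_psum => y.
have [[x _ <-]|/push_fun_out ->] := pselect (range i y).
  by rewrite push_fun_im.
by rewrite normc0 expr0n sqr_ge0.
Qed.

Fact pull_subproof g : g \o i \in l2_pred.
Proof.
by apply/l2_predP/(le_lt_trans (sqsum_pull g)); apply/l2_predP; exact: l2_funP.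
Qed.

Definition pull g : l2 K X := L2 (pull_subproof g).

Lemma pushE f x : push f (i x) = f x. Proof. exact: push_fun_im. Qed.

Lemma push_out f y : ~ range i y -> push f y = 0. Proof. exact: push_fun_out. Qed.

Lemma pullE g x : pull g x = g (i x). Proof. by []. Qed.

Lemma pushK : cancel push pull.
Proof. by move=> f; apply: l2P => x; rewrite pullE pushE. Qed.

Lemma push_eq f g : (forall x, g (i x) = f x) ->
  (forall y, ~ range i y -> g y = 0) -> push f = g.
Proof.
move=> gi g0; apply: l2P => y; have [[x _ <-]|h] := pselect (range i y).
  by rewrite pushE gi.
by rewrite push_out// g0.
Qed.

Lemma push_linear : linear push.
Proof.
move=> a f g; apply: push_eq => [x|y h]; rewrite l2D l2Z.
  by rewrite !pushE.
by rewrite !push_out// mulr0 addr0.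
Qed.

HB.instance Definition _ :=
  GRing.isLinear.Build K[i] (l2 K X) (l2 K Y) *:%R push push_linear.

Lemma pull_linear : linear pull.
Proof. by move=> a f g; exact: l2P. Qed.

HB.instance Definition _ :=
  GRing.isLinear.Build K[i] (l2 K Y) (l2 K X) *:%R pull pull_linear.

Lemma l2norm_push f : l2norm (push f) = l2norm f.
Proof. by rewrite /l2norm sqsum_push. Qed.

Lemma l2norm_pull g : l2norm (pull g) <= l2norm g.
Proof.
rewrite -(@ler_pXn2r _ 2) ?nnegrE ?l2norm_ge0// -lee_fin -!sqsum_l2norm.
exact: sqsum_pull.
Qed.

Lemma dot_push f g : dot (push f) g = dot f (pull g).
Proof.
rewrite /dot (csum_inj ii) => [|y /push_fun_out /= ->]; last by rewrite mul0r.
by congr csum; apply/funext => x /=; rewrite push_fun_im.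
Qed.

Lemma dot_pull f g : dot (pull g) f = dot g (push f).
Proof.
rewrite /dot [RHS](csum_inj ii) => [|y /push_fun_out /= ->]; last first.
  by rewrite conjc0 mulr0.
by congr csum; apply/funext => x /=; rewrite push_fun_im.
Qed.

Lemma push_delta x : push (delta x) = delta (i x).
Proof.
apply: push_eq => [z|y h] /=; first by rewrite (inj_eq ii).
by case: eqP => // yx; case: h; exists x.
Qed.

Lemma pull_delta x : pull (delta (i x)) = delta x.
Proof. by rewrite -push_delta pushK. Qed.

End PushPull.

Section PushOperators.
Context {K : realType} {X : choiceType} (i : X -> X) (ii : injective i).

Lemma bounded_op_push : bounded_op (push (K := K) ii).
Proof. by split; [exact: push_linear|exists 1 => f; rewrite l2norm_push mul1r]. Qed.

Lemma bounded_op_pull : bounded_op (pull (K := K) ii).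
Proof. by split; [exact: pull_linear|exists 1 => f; rewrite mul1r l2norm_pull]. Qed.

Lemma adjoint_op_push : adjoint_op (push (K := K) ii) (pull ii).
Proof. by split; [exact: bounded_op_push|exact: bounded_op_pull|exact: dot_push]. Qed.

Lemma isometry_op_push : isometry_op (push (K := K) ii).
Proof. by split; [exact: bounded_op_push|exact: l2norm_push]. Qed.

Lemma bounded_op_push_eq (T : l2 K X -> l2 K X) :
  bounded_op T -> (forall x, T (delta x) = delta (i x)) -> T = push ii.
Proof.
move=> bT h; apply: eq_bounded_op => // [|x]; first exact: bounded_op_push.
by rewrite h push_delta.
Qed.

Lemma unitary_op_push : (forall y, range i y) -> unitary_op (push (K := K) ii).
Proof.
move=> si; exists (pull ii); split; first exact: adjoint_op_push.
  by apply/funext => f /=; rewrite pushK.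
apply/funext => f; apply: push_eq => // y; by case.
Qed.

End PushOperators.

(** * The operators of the theorem as push-forwards on the index set *)

Section Operators.
Context {K : realType} {R : idomainType} {M : lmodType R}.
Local Notation I := (M * nonzero R)%type.
Local Notation H := (l2 K I).
Implicit Types (m n : M) (r s : nonzero R) (x : I).

Definition shift m x : I := (val x.2 *: m + x.1, x.2).
Definition dilate r x : I := (x.1, nz_mul r x.2).

Lemma shift_inj m : injective (shift m).
Proof. by move=> [n s] [n' s'] [+ ss]; rewrite /= ss => /addrI ->. Qed.

(** Cancellation of [r != 0] in the integral domain is what makes [S_r] an isometry. *)
Lemma dilate_inj r : injective (dilate r).
Proof.
move=> [n s] [n' s'] [-> /(mulfI (valP r)) ss].
by congr (_, _); exact/val_inj.
Qed.

Lemma shift_surj m x : range (shift m) x.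
Proof.
by exists (x.1 - val x.2 *: m, x.2) => //; rewrite /shift/= addrC subrK; case: x.
Qed.

(** Read from right to left this is existence of the family [U], from left to right its
    uniqueness. *)
Lemma translation_opsP (U : M -> H -> H) :
  translation_ops U <-> U = fun m => push (@shift_inj m).
Proof.
split=> [h|-> m]; last first.
  by split=> [|n s]; [exact: bounded_op_push|rewrite !tens_delta push_delta].
apply/funext => m; have [bU hU] := h m.
by apply: bounded_op_push_eq => // -[n s]; rewrite -tens_delta hU tens_delta.
Qed.

Lemma multiplication_opsP (S : nonzero R -> H -> H) :
  multiplication_ops S <-> S = fun r => push (@dilate_inj r).
Proof.
split=> [h|-> r]; last first.
  by split=> [|n s]; [exact: bounded_op_push|rewrite !tens_delta push_delta].
apply/funext => r; have [bS hS] := h r.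
by apply: bounded_op_push_eq => // -[n s]; rewrite -tens_delta hS tens_delta.
Qed.

End Operators.

(** * Adjoints *)

Section DotAdjoint.
Context {K : realType}.
Implicit Types X : choiceType.

Lemma l2_summable_Re X (f g : l2 K X) :
  abs_summable (fun x => complex.Re (f x * conjc (g x))).
Proof. exact: l2_dot_summable ler_norm_Re. Qed.

Lemma l2_summable_Im X (f g : l2 K X) :
  abs_summable (fun x => complex.Im (f x * conjc (g x))).
Proof. exact: l2_dot_summable ler_norm_Im. Qed.

Lemma abs_summableZ X (c : K) (a : X -> K) :
  abs_summable a -> abs_summable (fun x => c * a x).
Proof.
move=> ha; rewrite /abs_summable; under [X in psum X]funext do rewrite normrM.
by rewrite psumZ// (psum_fin _ ha)// -EFinM ltry.
Qed.

Lemma dotDl X (f g h : l2 K X) : dot (f + g) h = dot f h + dot g h.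
Proof.
have -> : dot f h + dot g h =
    ((complex.Re (dot f h) + complex.Re (dot g h)) +i*
     (complex.Im (dot f h) + complex.Im (dot g h)))%C by [].
rewrite /dot /csum /= -(rsumD (l2_summable_Re f h) (l2_summable_Re g h)).
rewrite -(rsumD (l2_summable_Im f h) (l2_summable_Im g h)).
by congr (_ +i* _)%C; congr rsum; apply/funext => x; rewrite mulrDl raddfD.
Qed.

Lemma dotZl X (c : K[i]) (f h : l2 K X) : dot (c *: f) h = c * dot f h.
Proof.
have -> : c * dot f h =
    ((complex.Re c * complex.Re (dot f h) + - complex.Im c * complex.Im (dot f h)) +i*
     (complex.Re c * complex.Im (dot f h) + complex.Im c * complex.Re (dot f h)))%C.
  by case: c (dot f h) => a b [a' b'] /=; rewrite mulNr.
have hR := l2_summable_Re f h; have hI := l2_summable_Im f h.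
have hZ c' := abs_summableZ c' hR; have hZ' c' := abs_summableZ c' hI.
rewrite /dot /csum /= -!(rsumZ _ hR) -!(rsumZ _ hI).
rewrite -(rsumD (hZ _) (hZ' _)) -(rsumD (hZ' _) (hZ _)).
congr (_ +i* _)%C; congr rsum; apply/funext => x.
  rewrite -[LHS]/(complex.Re (c * f x * conjc (h x))).
  by case: c (f x) (h x) => a b [a1 b1] [a2 b2] /=; ring.
rewrite -[LHS]/(complex.Im (c * f x * conjc (h x))).
by case: c (f x) (h x) => a b [a1 b1] [a2 b2] /=; ring.
Qed.

Lemma dotC X (f g : l2 K X) : dot f g = conjc (dot g f).
Proof.
rewrite /dot /csum /= -rsumN; congr (_ +i* _)%C; congr rsum; apply/funext => x.
  by case: (f x) (g x) => a b [a' b'] /=; ring.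
by case: (f x) (g x) => a b [a' b'] /=; ring.
Qed.

Lemma dotDr X (f g h : l2 K X) : dot h (f + g) = dot h f + dot h g.
Proof. by rewrite dotC dotDl (dotC h f) (dotC h g) -rmorphD. Qed.

Lemma dotZr X (c : K[i]) (f h : l2 K X) : dot h (c *: f) = conjc c * dot h f.
Proof. by rewrite dotC dotZl (dotC h f) -rmorphM. Qed.

Lemma adjoint_op_sym X (T T' : l2 K X -> l2 K X) :
  adjoint_op T T' -> adjoint_op T' T.
Proof. by move=> [bT bT' h]; split=> // f g; rewrite dotC -h -dotC. Qed.

Lemma adjoint_opD X (S S' T T' : l2 K X -> l2 K X) :
  adjoint_op S S' -> adjoint_op T T' ->
  adjoint_op (fun f => S f + T f) (fun f => S' f + T' f).
Proof.
move=> [bS bS' hS] [bT bT' hT]; split; [exact: bounded_opD..|] => f g.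
by rewrite dotDl dotDr hS hT.
Qed.

Lemma adjoint_opZ X (c : K[i]) (T T' : l2 K X -> l2 K X) :
  adjoint_op T T' -> adjoint_op (fun f => c *: T f) (fun f => conjc c *: T' f).
Proof.
move=> [bT bT' hT]; split; [exact: bounded_opZ..|] => f g.
by rewrite dotZl dotZr hT conjcK.
Qed.

Lemma adjoint_op_comp X (S S' T T' : l2 K X -> l2 K X) :
  adjoint_op S S' -> adjoint_op T T' -> adjoint_op (S \o T) (T' \o S').
Proof.
move=> [bS bS' hS] [bT bT' hT]; split; [exact: bounded_op_comp..|] => f g.
by rewrite /= hS hT.
Qed.

Lemma adjoint_op0 X :
  adjoint_op (fun _ : l2 K X => 0 : l2 K X) (fun _ : l2 K X => 0 : l2 K X).
Proof.
split; [exact: bounded_op0..|] => f g.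
by rewrite -(scale0r (0 : l2 K X)) dotZl dotZr conjc0 !mul0r.
Qed.

(** [|T' g|^2 = <T (T' g), g> <= c |T' g| |g|], and one factor [|T' g|] cancels. *)
Lemma op_bound_adjoint X (c : K) (T T' : l2 K X -> l2 K X) : 0 <= c ->
  adjoint_op T T' -> op_bound c T -> op_bound c T'.
Proof.
move=> c0 [_ _ TT'] hc g; have [->|g0] := eqVneq (l2norm (T' g)) 0.
  by rewrite mulr_ge0 ?l2norm_ge0.
have {}g0 : 0 < l2norm (T' g) by rewrite lt_def g0 l2norm_ge0.
rewrite -(ler_pM2r g0) -expr2 -rdot_l2norm /rdot -TT'.
apply: le_trans (rdot_le _ _) _.
by rewrite mulrAC ler_wpM2r ?l2norm_ge0.
Qed.

(** Since [|T f|^2 = <f, T' T f>], Cauchy-Schwarz suffices. The reverse half of the C*-identity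
    comes from [opnorm_comp] and [opnorm_adjoint]. *)
Lemma opnorm_cstar X (T T' : l2 K X -> l2 K X) :
  adjoint_op T T' -> opnorm T ^+ 2 <= opnorm (T' \o T).
Proof.
move=> [bT bT' TT']; have bTT := bounded_op_comp bT' bT.
have N0 := opnorm_ge0 bTT.
rewrite -(sqr_sqrtr N0) ler_pXn2r ?nnegrE ?sqrtr_ge0 ?opnorm_ge0//.
apply: opnorm_le; first exact: sqrtr_ge0.
move=> f; rewrite -(@ler_pXn2r _ 2) ?nnegrE ?mulr_ge0 ?sqrtr_ge0 ?l2norm_ge0//.
rewrite exprMn (sqr_sqrtr N0) -(rdot_l2norm (T f)) /rdot TT'.
apply: le_trans (rdot_le _ _) _.
by rewrite mulrC expr2 mulrA ler_wpM2r ?l2norm_ge0// op_bound_opnorm.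
Qed.

Lemma opnorm_comp X (S T : l2 K X -> l2 K X) :
  bounded_op S -> bounded_op T -> opnorm (S \o T) <= opnorm S * opnorm T.
Proof.
move=> bS bT; apply: opnorm_le => [|f]; first by rewrite mulr_ge0 ?opnorm_ge0.
apply: le_trans (op_bound_opnorm bS _) _.
by rewrite -mulrA ler_wpM2l ?opnorm_ge0// op_bound_opnorm.
Qed.

Lemma opnorm_adjoint X (T T' : l2 K X -> l2 K X) :
  adjoint_op T T' -> opnorm T' <= opnorm T.
Proof.
move=> TT'; have [bT _ _] := TT'.
apply: opnorm_le; first exact: opnorm_ge0.
exact: (op_bound_adjoint (opnorm_ge0 bT) TT' (op_bound_opnorm bT)).
Qed.

End DotAdjoint.

(** * Group algebra elements in unitary representations *)

Section GroupAlgebra.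
Context {K : realType} {G : zmodType}.
Implicit Types (l : seq (K[i] * G)) (g h : G).

(** An element of [C[G]] is an unreduced list of terms (coefficient, group element). Repetitions are
    allowed, so sums and products need no collecting; terms are collected only in [galg_coef] and
    [galg_supp]. The latter may keep elements whose coefficient cancels, which is harmless for upper
    bounds. *)
Definition galg_mul l l' : seq (K[i] * G) :=
  [seq (p.1 * q.1, p.2 + q.2) | p <- l, q <- l'].

Definition galg_star l : seq (K[i] * G) := [seq (conjc p.1, - p.2) | p <- l].

Definition galg_coef l g : K[i] := \sum_(p <- l | p.2 == g) p.1.

Definition galg_supp l : seq G := undup (unzip2 l).

Definition galg_op X (pi : G -> l2 K X -> l2 K X) l (f : l2 K X) : l2 K X :=
  \sum_(p <- l) p.1 *: pi p.2 f.

Section Representation.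
Context {X : choiceType} (pi : G -> l2 K X -> l2 K X) (rpi : unitary_rep pi).

Lemma galg_op_nil : galg_op pi [::] = fun=> 0.
Proof. by apply/funext => f; rewrite /galg_op big_nil. Qed.

Lemma galg_op_cons p l :
  galg_op pi (p :: l) = fun f => p.1 *: pi p.2 f + galg_op pi l f.
Proof. by apply/funext => f; rewrite /galg_op big_cons. Qed.

(** The adjoint provided by unitarity is a left inverse of [pi g] and [pi (- g)] is a right inverse,
    so the two agree. *)
Lemma unitary_rep_adjoint g : adjoint_op (pi g) (pi (- g)).
Proof.
have [/(_ g)[T' [TT' T'T _]] p0 pD] := rpi.
suff -> : pi (- g) = T' by [].
have gN : pi g \o pi (- g) = id by rewrite -pD subrr p0.
by rewrite -[RHS]/(T' \o id) -gN compA T'T.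
Qed.

Lemma unitary_rep_bounded g : bounded_op (pi g).
Proof. by have [] := unitary_rep_adjoint g. Qed.

Lemma unitary_rep_l2norm g f : l2norm (pi g f) = l2norm f.
Proof.
have [_ _ h] := unitary_rep_adjoint g; have [_ p0 pD] := rpi.
apply/eqP; rewrite -(@eqrXn2 _ 2) ?l2norm_ge0// -!rdot_l2norm /rdot h.
by rewrite -[pi (- g) _]/((pi (- g) \o pi g) f) -pD addNr p0.
Qed.

Lemma galg_op_bounded l : bounded_op (galg_op pi l).
Proof.
elim: l => [|p l IH]; first by rewrite galg_op_nil; exact: bounded_op0.
by rewrite galg_op_cons; apply: bounded_opD => //;
  apply: bounded_opZ; exact: unitary_rep_bounded.
Qed.

Lemma galg_op_cat l l' f :
  galg_op pi (l ++ l') f = galg_op pi l f + galg_op pi l' f.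
Proof. by rewrite /galg_op big_cat. Qed.

Lemma galg_op_scale c l f :
  galg_op pi [seq (c * p.1, p.2) | p <- l] f = c *: galg_op pi l f.
Proof.
by rewrite /galg_op big_map scaler_sumr; apply: eq_bigr => p _; rewrite scalerA.
Qed.

Lemma galg_op_mul l l' : galg_op pi (galg_mul l l') = galg_op pi l \o galg_op pi l'.
Proof.
have [_ _ pD] := rpi.
apply/funext => f; rewrite /galg_op big_allpairs_dep /=; apply: eq_bigr => p _.
have [L LE _] := bounded_op_linear (unitary_rep_bounded p.2).
rewrite LE linear_sum scaler_sumr; apply: eq_bigr => q _ /=.
by rewrite pD linearZ scalerA -LE.
Qed.

Lemma galg_op_star l : adjoint_op (galg_op pi l) (galg_op pi (galg_star l)).
Proof.
elim: l => [|p l IH]; first by rewrite !galg_op_nil; exact: adjoint_op0.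
by rewrite /= !galg_op_cons; apply: adjoint_opD => //=;
  apply: adjoint_opZ; exact: unitary_rep_adjoint.
Qed.

Lemma galg_op_supp l f :
  galg_op pi l f = \sum_(g <- galg_supp l) galg_coef l g *: pi g f.
Proof.
rewrite /galg_op /galg_coef /galg_supp.
under [RHS]eq_bigr do rewrite scaler_suml big_mkcond.
rewrite exchange_big /= [LHS]big_seq [RHS]big_seq; apply: eq_bigr => p pl.
rewrite (bigD1_seq p.2) ?undup_uniq ?mem_undup ?map_f//= eqxx big1 ?addr0//.
by move=> g; rewrite eq_sym => /negPf ->.
Qed.

End Representation.

Lemma left_regular_inj g : injective (fun h => g + h).
Proof. exact: addrI. Qed.

Lemma left_regularE g : left_regular (K := K) g = push (@left_regular_inj g).
Proof.
apply/funext => f; apply/esym/push_eq => [h /=|h []].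
  by rewrite addrAC subrr add0r.
by exists (h - g) => //; rewrite addrC subrK.
Qed.

Lemma left_regular_rep : unitary_rep (@left_regular K G).
Proof.
split.
- move=> g; rewrite left_regularE; apply: unitary_op_push => h.
  by exists (h - g) => //; rewrite addrC subrK.
- by apply/funext => f; apply: l2P => h /=; rewrite subr0.
- by move=> g h; apply/funext => f; apply: l2P => k /=; rewrite opprD addrA.
Qed.

(** The translates of [delta 0] are distinct basis vectors, so the regular representation displays
    every coefficient as an entry of one vector. A general representation has no such vector; it may
    even be trivial. *)
Lemma galg_coef_regular l g : galg_op left_regular l (delta 0) g = galg_coef l g.
Proof.
rewrite /galg_op /galg_coef; elim: l => [|p l IH]; first by rewrite !big_nil.
rewrite !big_cons l2D IH l2Z left_regular_delta addr0 /= eq_sym.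
by case: eqP; rewrite ?mulr1 ?mulr0 ?add0r.
Qed.

Lemma normc_galg_coef l g : normc (galg_coef l g) <= opnorm (galg_op left_regular l).
Proof.
rewrite -galg_coef_regular; apply: le_trans (normc_le_l2norm _ _) _.
have := op_bound_opnorm (galg_op_bounded left_regular_rep l) (delta 0).
by rewrite l2norm_delta mulr1.
Qed.

(** Each [pi g] is isometric, so the triangle inequality applies term by term. The factor lost here
    is removed later by passing to powers. *)
Lemma galg_op_le_supp X (pi : G -> l2 K X -> l2 K X) l : unitary_rep pi ->
  opnorm (galg_op pi l) <= (size (galg_supp l))%:R * opnorm (galg_op left_regular l).
Proof.
move=> rpi; apply: opnorm_le.
  by rewrite mulr_ge0// opnorm_ge0//; apply: galg_op_bounded left_regular_rep _.
move=> f; rewrite galg_op_supp; apply: le_trans (l2norm_sum _ _) _.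
apply: (@le_trans _ _ (\sum_(g <- galg_supp l)
    opnorm (galg_op left_regular l) * l2norm f)).
  apply: ler_sum => g _; rewrite l2normZ (unitary_rep_l2norm rpi).
  by rewrite ler_wpM2r ?l2norm_ge0// normc_galg_coef.
by rewrite big_const_seq count_predT iter_addr_0 -mulrA mulr_natl.
Qed.

Definition galg_pow2 j l := iter j (fun l => galg_mul l l) l.

(* Commutativity makes the support of a power grow only polynomially. *)
Lemma mem_galg_pow2 l j g : g \in unzip2 (galg_pow2 j l) ->
  exists t : {ffun 'I_(size l) -> 'I_(2 ^ j).+1},
    g = \sum_(i < size l) (nth 0 (unzip2 l) i) *+ t i.
Proof.
elim: j g => [g /(nthP 0)[k]|j IH g].
  rewrite size_map => kl <-.
  (* Exponents range over [0, ..., 2 ^ 0], so [ord_max] is the exponent 1. *)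
  exists [ffun i => if i == Ordinal kl then ord_max else ord0].
  rewrite (bigD1 (Ordinal kl))//= ffunE eqxx big1 ?addr0// => i /negPf ik.
  by rewrite ffunE ik mulr0n.
move=> /mapP[_ /allpairsP[[p q] [/= pl ql ->]] ->] /=.
have [t Et] := IH _ (map_f snd pl); have [u Eu] := IH _ (map_f snd ql).
(* Both exponents are at most [2 ^ j], so their sum is at most [2 ^ j.+1] and [inord] does not fall
   back to its default. *)
exists [ffun i => inord (t i + u i)].
rewrite Et Eu -big_split; apply: eq_bigr => i _ /=.
rewrite ffunE inordK ?mulrnDr// ltnS expnS mul2n -addnn.
by rewrite leq_add// -ltnS.
Qed.

Lemma size_galg_supp_pow2 l j :
  (size (galg_supp (galg_pow2 j l)) <= (2 ^ j).+1 ^ size l)%N.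
Proof.
pose F (t : {ffun 'I_(size l) -> 'I_(2 ^ j).+1}) : G :=
  \sum_(i < size l) (nth 0 (unzip2 l) i) *+ t i.
rewrite -[X in (_ <= _ ^ X)%N]card_ord -[X in (_ <= X ^ _)%N]card_ord -card_ffun.
rewrite cardE -(size_map F); apply: uniq_leq_size; first exact: undup_uniq.
move=> g; rewrite mem_undup => /mem_galg_pow2[t ->].
by apply: map_f; rewrite mem_enum.
Qed.

End GroupAlgebra.

(** If [x / y = 1 + d] with [d > 0], Bernoulli gives [1 + N d <= (1 + d)^N], only linear in
    [N = 2^j]. Raised to a power [q > k] it yields [(N d)^q <= (1 + d)^(N q) <= (N q + 1)^k <= (2 q
    N)^k], which forces [N <= C], absurd for large [j]. *)
Lemma le_of_pow2_growth (K : realType) (x y : K) (k : nat) : 0 <= x -> 0 <= y ->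
  (forall j, x ^+ (2 ^ j) <= ((2 ^ j).+1 ^ k)%N%:R * y ^+ (2 ^ j)) -> x <= y.
Proof.
move=> x0 y0 h; rewrite leNgt; apply/negP => yx.
have [y_eq0|y_neq0] := eqVneq y 0.
  have := h 0%N; rewrite expn0 !expr1 y_eq0 mulr0.
  by rewrite y_eq0 in yx; rewrite leNgt yx.
have {}y0 : 0 < y by rewrite lt_def y_neq0.
have [d d0 dE] : exists2 d, 0 < d & x / y = 1 + d.
  by exists (x / y - 1); [rewrite subr_gt0 ltr_pdivlMr ?mul1r|rewrite addrC subrK].
have {}h j : (1 + d) ^+ (2 ^ j) <= ((2 ^ j).+1 ^ k)%N%:R.
  by rewrite -dE expr_div_n ler_pdivrMr ?exprn_gt0.
have bern m : 1 + m%:R * d <= (1 + d) ^+ m.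
  elim: m => [|m IH]; first by rewrite mul0r addr0 expr0.
  rewrite exprS -nat1r; have m0 : 0 <= m%:R * d by rewrite mulr_ge0// ltW.
  by apply: (@le_trans _ _ ((1 + d) * (1 + m%:R * d)));
    [nra|rewrite ler_wpM2l// addr_ge0// ltW].
(* [q] exceeds [k] and is a power of two, so that [N q = 2 ^ (j + k)] is again an exponent covered
   by [h]. *)
pose q := (2 ^ k)%N; have kq : (k < q)%N by rewrite ltn_expl.
pose C : K := ((2 * q) ^ k)%N%:R / d ^+ q.
have dq : 0 < d ^+ q by rewrite exprn_gt0.
suff B j : (2 ^ j)%N%:R <= C.
  have [n Cn] : exists n, C < n%:R.
    by exists (Num.bound C); rewrite archi_boundP// divr_ge0// ltW.
  have := lt_le_trans (le_lt_trans (B n) Cn) (ltW (_ : n%:R < (2 ^ n)%N%:R)).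
  by rewrite ltxx => /(_ _); rewrite ltr_nat ltn_expl// => /(_ isT).
pose N : K := (2 ^ j)%N%:R.
have N1 : 1 <= N by rewrite ler1n expn_gt0.
have N0 : 0 < N by rewrite (lt_le_trans _ N1).
rewrite -/N ler_pdivlMr//.
rewrite -(@ler_pM2l _ (N ^+ k)) ?exprn_gt0//.
apply: (@le_trans _ _ ((N * d) ^+ q)).
  rewrite exprMn mulrA ler_wpM2r ?(ltW dq)// -exprSr ler_weXn2l//.
apply: (@le_trans _ _ ((1 + d) ^+ (2 ^ (j + k)))).
  have Nd0 : 0 <= N * d by rewrite mulr_ge0 ?ltW.
  have d10 : 0 <= 1 + d by rewrite addr_ge0 ?ltW.
  rewrite expnD exprM ler_pXn2r ?nnegrE ?exprn_ge0 ?expn_gt0//.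
  by apply: le_trans (bern _); rewrite lerDr.
apply: le_trans (h _) _.
rewrite /N -natrX -natrM ler_nat -expnMn.
have [->|k0] := posnP k; first by rewrite !expn0.
rewrite leq_exp2r// mulnCA mul2n -expnD -addnn -addn1 leq_add2l.
by rewrite expn_gt0.
Qed.

(** Replacing [l] by [b] squares both norms and makes the element self-adjoint, so that the norms of
    its powers are known. The conclusion is the norm form of amenability: no unitary representation
    exceeds the reduced norm. *)
Lemma galg_op_le_regular (K : realType) (G : zmodType) (X : choiceType)
    (pi : G -> l2 K X -> l2 K X) (l : seq (K[i] * G)) : unitary_rep pi ->
  opnorm (galg_op pi l) <= opnorm (galg_op left_regular l).
Proof.
move=> rpi; have rlam := @left_regular_rep K G.
pose b := galg_mul (galg_star l) l.
have bE Y (ro : G -> l2 K Y -> l2 K Y) (rro : unitary_rep ro) :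
    opnorm (galg_op ro b) = opnorm (galg_op ro l) ^+ 2.
  have A := galg_op_star rro l; have [bA bA' _] := A.
  rewrite galg_op_mul//; apply/eqP; rewrite eq_le opnorm_cstar// andbT.
  apply: le_trans (opnorm_comp bA' bA) _.
  by rewrite expr2 ler_wpM2r ?opnorm_ge0// opnorm_adjoint.
have pE Y (ro : G -> l2 K Y -> l2 K Y) (rro : unitary_rep ro) j :
    opnorm (galg_op ro (galg_pow2 j b)) = opnorm (galg_op ro b) ^+ (2 ^ j).
  (* Self-adjointness is carried through the induction, because [opnorm_cstar] bounds the norm of a
     square only for a self-adjoint operator. *)
  suff [_ ->//] : adjoint_op (galg_op ro (galg_pow2 j b)) (galg_op ro (galg_pow2 j b)) /\
      opnorm (galg_op ro (galg_pow2 j b)) = opnorm (galg_op ro b) ^+ (2 ^ j).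
  elim: j => [|j [sa IH]] /=.
    split; last by rewrite expn0 expr1.
    rewrite galg_op_mul//; apply: adjoint_op_comp.
      exact/adjoint_op_sym/galg_op_star.
    exact: galg_op_star.
  rewrite galg_op_mul//; split; first exact: adjoint_op_comp.
  have [bB _ _] := sa.
  rewrite expnSr exprM -IH; apply/eqP; rewrite eq_le opnorm_cstar// andbT.
  exact: opnorm_comp.
have N0 Y (ro : G -> l2 K Y -> l2 K Y) (rro : unitary_rep ro) l' :
    0 <= opnorm (galg_op ro l') by apply: opnorm_ge0; exact: galg_op_bounded.
rewrite -(@ler_pXn2r _ 2) ?nnegrE ?N0// -!bE//.
apply: (@le_of_pow2_growth _ _ _ (size b)); rewrite ?N0// => j.
rewrite -!pE//; apply: le_trans (galg_op_le_supp _ rpi) _.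
by rewrite ler_wpM2r ?N0// ler_nat size_galg_supp_pow2.
Qed.

(** * The C*-algebra generated by a representation *)

Section Closure.
Context {K : realType} {G : zmodType} {X : choiceType}.
Variables (pi : G -> l2 K X -> l2 K X) (rpi : unitary_rep pi).

(** [op_bound] stands in for [opnorm] so that errors can be estimated vector by vector. *)
Definition galg_closure : set (l2 K X -> l2 K X) :=
  [set T | bounded_op T /\ forall e : K, 0 < e ->
    exists l, op_bound e (fun f => T f - galg_op pi l f)].

Lemma galg_op_closure l : galg_closure (galg_op pi l).
Proof.
split=> [|e e0]; first exact: galg_op_bounded.
by exists l => f; rewrite subrr l2norm0 mulr_ge0 ?l2norm_ge0// ltW.
Qed.

Lemma galg_closureD S T : galg_closure S -> galg_closure T ->
  galg_closure (fun f => S f + T f).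
Proof.
move=> [bS hS] [bT hT]; split=> [|e e0]; first exact: bounded_opD.
have e20 : 0 < e / 2 by rewrite divr_gt0.
have [l hl] := hS _ e20; have [l' hl'] := hT _ e20.
exists (l ++ l') => f; rewrite galg_op_cat opprD addrACA.
apply: le_trans (l2normD _ _) _; apply: le_trans (lerD (hl f) (hl' f)) _.
by rewrite -mulrDl -splitr.
Qed.

Lemma galg_closureZ c T : galg_closure T -> galg_closure (fun f => c *: T f).
Proof.
move=> [bT hT]; split=> [|e e0]; first exact: bounded_opZ.
have c0 : 0 < normc c + 1 by rewrite ltr_wpDl ?normc_ge0.
have [l hl] := hT _ (divr_gt0 e0 c0).
exists [seq (c * p.1, p.2) | p <- l] => f.
rewrite galg_op_scale -scalerBr l2normZ.
apply: (@le_trans _ _ ((normc c + 1) * (e / (normc c + 1) * l2norm f))).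
  by rewrite ler_pM ?normc_ge0 ?l2norm_ge0// lerDl.
by rewrite mulrA mulrCA divff ?gt_eqF// mulr1.
Qed.

Lemma galg_closureM S T : galg_closure S -> galg_closure T -> galg_closure (S \o T).
Proof.
move=> [bS hS] [bT hT]; split=> [|e e0]; first exact: bounded_op_comp.
have [L LE [c c0 hc]] := bounded_op_linear bS.
have cp : 0 < c + 1 by rewrite ltr_wpDl.
have e20 : 0 < e / 2 by rewrite divr_gt0.
(* The order matters: the tolerance for [l] depends on the norm of [galg_op pi l']. Adding 1 to both
   bounds avoids division by zero. *)
have [l' hl'] := hT _ (divr_gt0 e20 cp).
have bl' := galg_op_bounded rpi l'; have hd := op_bound_opnorm bl'.
pose d := opnorm (galg_op pi l'); have d0 : 0 <= d := opnorm_ge0 bl'.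
have dp : 0 < d + 1 by rewrite ltr_wpDl.
have [l hl] := hS _ (divr_gt0 e20 dp).
exists (galg_mul l l') => f; rewrite galg_op_mul//=.
pose g := galg_op pi l' f.
have -> : S (T f) - galg_op pi l g = L (T f - g) + (S g - galg_op pi l g).
  by rewrite LE linearB addrA subrK.
apply: le_trans (l2normD _ _) _; rewrite [e in e * _]splitr mulrDl; apply: lerD.
  apply: le_trans (hc _) _.
  apply: (@le_trans _ _ ((c + 1) * (e / 2 / (c + 1) * l2norm f))).
    by rewrite ler_pM ?l2norm_ge0// ?lerDl//; exact: hl'.
  by rewrite mulrA mulrCA divff ?gt_eqF// mulr1.
apply: le_trans (hl _) _.
apply: (@le_trans _ _ (e / 2 / (d + 1) * ((d + 1) * l2norm f))).
  rewrite ler_wpM2l ?(ltW (divr_gt0 e20 dp))//.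
  by apply: le_trans (hd f) _; rewrite ler_wpM2r ?l2norm_ge0// lerDl.
by rewrite mulrA divfK ?gt_eqF.
Qed.

(** Passing to adjoints keeps the error bound, so the star of an approximant of [T] approximates
    [T']. *)
Lemma galg_closure_adjoint T T' :
  galg_closure T -> adjoint_op T T' -> galg_closure T'.
Proof.
move=> [bT hT] TT'; have [_ bT' _] := TT'; split=> // e e0.
have [l hl] := hT _ e0; exists (galg_star l).
apply: op_bound_adjoint hl; first exact: ltW.
have := adjoint_opD TT' (adjoint_opZ (-1) (galg_op_star rpi l)).
have N1 : conjc (-1) = -1 :> K[i] by rewrite rmorphN rmorph1.
by rewrite N1; congr adjoint_op; apply/funext => f; rewrite scaleN1r.
Qed.

Lemma galg_closure_closed T : bounded_op T ->
  (forall e : K, 0 < e ->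
    exists2 S, galg_closure S & opnorm (fun f => T f - S f) < e) ->
  galg_closure T.
Proof.
move=> bT h; split=> // e e0; have e20 : 0 < e / 2 by rewrite divr_gt0.
have [S [bS hS] TS] := h _ e20; have [l hl] := hS _ e20; exists l => f.
rewrite -(subrK (S f) (T f)) -addrA [e in e * _]splitr mulrDl.
apply: le_trans (l2normD _ _) (lerD _ (hl f)).
apply: le_trans (op_bound_opnorm (bounded_opB bT bS) f) _.
by rewrite ler_wpM2r ?l2norm_ge0// ltW.
Qed.

Lemma galg_closure_cstar : is_cstar_subalgebra galg_closure.
Proof.
split.
- by move=> T [].
- by rewrite -(galg_op_nil pi); exact: galg_op_closure.
- exact: galg_closureD.
- exact: galg_closureZ.
- exact: galg_closureM.
- exact: galg_closure_adjoint.
- exact: galg_closure_closed.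
Qed.

Lemma galg_op_sub_cstar (A : set (l2 K X -> l2 K X)) l :
  is_cstar_subalgebra A -> range pi `<=` A -> A (galg_op pi l).
Proof.
move=> cA piA; elim: l => [|p l IH]; first by rewrite galg_op_nil; exact: cstar_zero.
rewrite galg_op_cons; apply: (cstar_add cA) => //; apply: (cstar_scale cA).
by apply: piA; exists p.2.
Qed.

(** The closure is itself a C*-algebra containing [range pi], and any other one contains all finite
    sums and hence their limits. This trades an abstract intersection for approximation by finite
    sums. *)
Lemma cstar_gen_rep : cstar_gen (range pi) = galg_closure.
Proof.
apply/seteqP; split.
  apply: smallest_sub; first exact: galg_closure_cstar.
  move=> _ [g _ <-]; have := galg_op_closure [:: (1, g)].
  congr galg_closure; apply/funext => f.
  by rewrite galg_op_cons galg_op_nil addr0 scale1r.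
move=> T [bT hT] A [cA piA]; apply: (cstar_closed cA) => // e e0.
have e20 : 0 < e / 2 by rewrite divr_gt0.
have [l hl] := hT _ e20; exists (galg_op pi l); first exact: galg_op_sub_cstar.
apply: (@le_lt_trans _ _ (e / 2)); first by apply: opnorm_le; rewrite ?ltW.
by rewrite ltr_pdivrMr// ltr_pMr// ltr1n.
Qed.

End Closure.

(** * Completeness of the algebra of bounded operators *)

Section Completeness.
Context {K : realType}.
Local Notation inv n := ((n%:R + 1 : K)^-1).

(** The intervals of radius [e n] about [u n] meet pairwise, so the supremum of their left ends lies
    in all of them. The rate comes with the limit. *)
Lemma real_limit (u e : nat -> K) :
  (forall n m, `|u n - u m| <= e n + e m) -> exists z, forall n, `|u n - z| <= e n.
Proof.
move=> h; have ub m : ubound (range (fun n => u n - e n)) (u m + e m).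
  move=> _ [n _ <-]; have := h n m; rewrite ler_norml => /andP[_]; lra.
have hs : has_sup (range (fun n => u n - e n)).
  by split; [exists (u 0%N - e 0%N), 0%N|exists (u 0%N + e 0%N)].
exists (sup (range (fun n => u n - e n))) => n.
have h1 : u n - e n <= sup (range (fun n => u n - e n)).
  by apply: sup_upper_bound => //; exists n.
have h2 : sup (range (fun n => u n - e n)) <= u n + e n.
  by apply: ge_sup => //; case: hs.
by rewrite ler_norml; lra.
Qed.

(** The factor 2 is the price of treating real and imaginary parts separately. *)
Lemma complex_limit (u : nat -> K[i]) (e : nat -> K) :
  (forall n m, normc (u n - u m) <= e n + e m) ->
  exists z, forall n, normc (u n - z) <= 2 * e n.
Proof.
move=> h.
have [a ha] : exists a, forall n, `|complex.Re (u n) - a| <= e n.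
  apply: real_limit => n m; rewrite -raddfB.
  exact: le_trans (ler_norm_Re _) (h n m).
have [b hb] : exists b, forall n, `|complex.Im (u n) - b| <= e n.
  apply: real_limit => n m; rewrite -raddfB.
  exact: le_trans (ler_norm_Im _) (h n m).
exists (a +i* b)%C => n; apply: le_trans (normc_le_ReIm _) _.
by rewrite !raddfB/= mulr_natl mulr2n lerD.
Qed.

Lemma le0_inv (x c : K) : (forall n, x <= c * inv n) -> x <= 0.
Proof.
move=> h; rewrite leNgt; apply/negP => x0.
have n0 n : 0 < n%:R + 1 :> K by rewrite ltr_wpDl.
have c0 : 0 <= c by have := h 0%N; rewrite add0r invr1 mulr1; lra.
have := h (Num.bound (c / x)); rewrite ler_pdivlMr//.
have := archi_boundP (divr_ge0 c0 (ltW x0)).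
rewrite ltr_pdivrMr// => h1 h2; nra.
Qed.

(** The limit is built entry by entry, which gives no control in [l2] by itself; [hs] recovers it on
    finite sets of indices, uniformly in the set. *)
Lemma op_limit (X : choiceType) (T : nat -> l2 K X -> l2 K X) :
  (forall n, bounded_op (T n)) ->
  (forall n m, op_bound (inv n + inv m) (fun f => T n f - T m f)) ->
  exists2 T', bounded_op T' &
    forall n, op_bound (4 * inv n) (fun f => T n f - T' f).
Proof.
move=> bT hT.
have i0 n : 0 < inv n by rewrite invr_gt0 ltr_wpDl.
have /choice[z hz] (p : l2 K X * X) :
    exists z, forall n, normc (T n p.1 p.2 - z) <= 2 * (inv n * l2norm p.1).
  apply: complex_limit => n m; rewrite -mulrDl.
  exact: le_trans (normc_le_l2norm (T n p.1 - T m p.1) p.2) (hT n m p.1).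
have hs n f (s : seq X) : uniq s ->
    \sum_(x <- s) normc (T n f x - z (f, x)) ^+ 2 <= (4 * inv n * l2norm f) ^+ 2.
  (* The intermediate [T m] depends on [s]: [m + 1 = (n + 1) (size s + 1)], so the entrywise errors
     remain bounded after summation over [s]. In units of [(a F)^2] the two parts give
     [2 (1 + t)^2 <= 8] and [8 (size s) t^2 <= 8], together [16 = 4^2]. *)
  move=> us; pose t := inv (size s); pose m := (n.+1 * (size s).+1).-1.
  have mE : inv m = inv n * t.
    by rewrite /m /t -invfM !natr1 prednK ?muln_gt0// natrM.
  have t0 : 0 < t := i0 _.
  have tE : ((size s)%:R + 1) * t = 1 by rewrite /t mulfV// gt_eqF// ltr_wpDl.
  have k0 : 0 <= (size s)%:R :> K by [].
  have t2 : t <= 1 by nra.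
  have t1 : (size s)%:R * t ^+ 2 <= 1 by nra.
  apply: (@le_trans _ _ (\sum_(x <- s)
      (2 * normc ((T n f - T m f) x) ^+ 2 + 2 * (2 * (inv m * l2norm f)) ^+ 2))).
    apply: ler_sum => x _.
    have -> : T n f x - z (f, x) =
        1 * (T n f - T m f) x + (T m f x - z (f, x)).
      by rewrite mul1r l2D l2N addrA subrK.
    apply: le_trans (normc_parallel _ _ _) _.
    rewrite normc1 expr1n mulr1 lerD2l ler_pM2l//.
    rewrite ler_pXn2r ?nnegrE ?normc_ge0//; first exact: (hz (f, x) m).
    by rewrite !mulr_ge0 ?l2norm_ge0// ltW.
  rewrite big_split /= -mulr_sumr big_const_seq count_predT iter_addr_0.
  have := le_trans (sum_le_l2norm (T n f - T m f) us)
    (_ : _ <= ((inv n + inv m) * l2norm f) ^+ 2).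
  rewrite ler_pXn2r ?nnegrE ?l2norm_ge0 ?mulr_ge0 ?addr_ge0 ?(ltW (i0 _)) ?l2norm_ge0//.
  move=> /(_ (hT n m f)).
  rewrite mE; set S := \sum_(_ <- _) _; set F := l2norm f.
  set a := inv n => hS.
  have hE : (a + a * t) * F = (1 + t) * (a * F) by ring.
  have -> : 2 * (2 * (a * t * F)) ^+ 2 *+ size s =
      (size s)%:R * t ^+ 2 * (8 * (a * F) ^+ 2).
    by rewrite -[LHS]mulr_natr; ring.
  rewrite hE exprMn in hS; rewrite -[4 * a * F]mulrA.
  have P0 : 0 <= (a * F) ^+ 2 := sqr_ge0 _.
  have h1 : (size s)%:R * t ^+ 2 * (8 * (a * F) ^+ 2) <= 8 * (a * F) ^+ 2.
    by rewrite ler_piMl// mulr_ge0.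
  have h2 : (1 + t) ^+ 2 * (a * F) ^+ 2 <= 4 * (a * F) ^+ 2.
    by rewrite ler_wpM2r//; nra.
  by move: hS h1 h2; lra.
have zP f : (fun x => z (f, x)) \in l2_pred.
  have hP : (fun x => T 0%N f x - z (f, x)) \in l2_pred.
    by apply/l2_predP; apply: le_lt_trans (psum_le (hs 0%N f)) _; rewrite ltry.
  have -> : (fun x => z (f, x)) =
      (T 0%N f : X -> K[i]) - (fun x => T 0%N f x - z (f, x)).
    by apply/funext => x /=; rewrite /= subKr.
  by rewrite rpredB ?l2_funP.
pose T' f := L2 (zP f).
have hT' n : op_bound (4 * inv n) (fun f => T n f - T' f).
  move=> f; apply: l2norm_le; first by rewrite !mulr_ge0 ?l2norm_ge0 ?ltW.
  exact: hs.
exists T' => //; split=> [a f g|].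
  apply/eqP; rewrite -subr_eq0; apply/eqP/l2norm_eq0.
  pose c := l2norm (a *: f + g) + normc a * l2norm f + l2norm g.
  apply: (@le0_inv _ (4 * c)) => n; rewrite /c.
  have [L LE _] := bounded_op_linear (bT n).
  (* [T n] is linear, so the linearity defect of [T'] is a combination of errors of [T n], each of
     order [1 / (n + 1)]. *)
  have -> : T' (a *: f + g) - (a *: T' f + T' g) =
      (a *: (T n f - T' f) + (T n g - T' g)) - (T n (a *: f + g) - T' (a *: f + g)).
    have E (A B w : l2 K X) : w - B = (A - B) - (A - w).
      by rewrite opprB [RHS]addrC addrA subrK.
    have -> : a *: (T n f - T' f) + (T n g - T' g) =
        (a *: T n f + T n g) - (a *: T' f + T' g).
      by rewrite scalerBr opprD addrACA.
    by rewrite LE (linearP L a f g); exact: E.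
  apply: le_trans (l2normB _ _) _.
  have h1 := hT' n (a *: f + g); have h2 := hT' n f; have h3 := hT' n g.
  have h4 := l2normD (a *: (T n f - T' f)) (T n g - T' g); rewrite l2normZ in h4.
  have h5 := ler_wpM2l (normc_ge0 a) h2.
  by move: h1 h3 h4 h5 => /=; lra.
have [_ [c hc]] := bT 0%N; exists (c + 4 * inv 0%N) => f.
rewrite -(subKr (T 0%N f) (T' f)) mulrDl; apply: le_trans (l2normB _ _) _.
by apply: lerD; [exact: hc|exact: hT'].
Qed.

End Completeness.

(** * Compression to an invariant subspace *)

Section Isomorphism.
Context {K : realType} {G : zmodType} {X Y : choiceType}.
Variables (pi : G -> l2 K X -> l2 K X) (ro : G -> l2 K Y -> l2 K Y).
Hypothesis rpi : unitary_rep pi.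
Variables (i : Y -> X) (ii : injective i).
Hypothesis pi_ro : forall g f, pi g (push ii f) = push ii (ro g f).
Hypothesis pi_le_ro : forall l, opnorm (galg_op pi l) <= opnorm (galg_op ro l).

Definition compress (T : l2 K X -> l2 K X) : l2 K Y -> l2 K Y :=
  pull ii \o T \o push ii.

Lemma galg_op_push l f : galg_op pi l (push ii f) = push ii (galg_op ro l f).
Proof.
by rewrite /galg_op linear_sum; apply: eq_bigr => p _; rewrite linearZ/= pi_ro.
Qed.

Lemma compress_bounded T : bounded_op T -> bounded_op (compress T).
Proof.
move=> /bounded_op_linear[L -> [c c0 hc]].
split=> [a f g|]; first by rewrite /compress /= !linearP.
exists c => f; apply: le_trans (l2norm_pull _ _) _.
by rewrite -(l2norm_push ii).
Qed.

Lemma compress_approx T l e :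
  op_bound e (fun f => T f - galg_op pi l f) ->
  op_bound e (fun f => compress T f - galg_op ro l f).
Proof.
move=> h f; rewrite /compress/= -[galg_op ro l f](pushK ii) -galg_op_push -linearB.
by apply: le_trans (l2norm_pull _ _) _; rewrite -(l2norm_push ii).
Qed.

Lemma compress_closure T : galg_closure pi T -> galg_closure ro (compress T).
Proof.
move=> [bT hT]; split=> [|e e0]; first exact: compress_bounded.
by have [l /compress_approx hl] := hT _ e0; exists l.
Qed.

(* The range of [push ii] is invariant under the norm closure, so compression
   to it is multiplicative there. *)
Lemma compressK T f : galg_closure pi T -> push ii (compress T f) = T (push ii f).
Proof.
move=> [bT hT]; apply/eqP; rewrite eq_sym -subr_eq0; apply/eqP/l2norm_eq0.
apply/ler_addgt0Pr => e e0; rewrite add0r.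
(* Two errors of size [d |f|] will be added, with [d = e / (2 (|f| + 1))]; the 1 covers [f = 0]. *)
have F0 : 0 < 2 * (l2norm f + 1) by rewrite mulr_gt0// ltr_wpDl ?l2norm_ge0.
have [l hl] := hT _ (divr_gt0 e0 F0); have hl' := compress_approx hl.
set S := galg_op ro l f.
have -> : T (push ii f) - push ii (compress T f) =
    (T (push ii f) - push ii S) - push ii (compress T f - S).
  by rewrite linearB opprB addrA subrK.
apply: le_trans (l2normB _ _) _; rewrite l2norm_push.
have := hl (push ii f); rewrite /= galg_op_push l2norm_push => h1.
have h2 := hl' f.
apply: le_trans (lerD h1 h2) _.
have dE : e / (2 * (l2norm f + 1)) * (2 * (l2norm f + 1)) = e.
  by rewrite divfK// gt_eqF.
by move: dE (divr_gt0 e0 F0); set d := e / _; lra.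
Qed.

(** An approximant [l] of [S - T] has small [galg_op ro l], because [S - T] compresses to zero;
    [pi_le_ro] then makes [galg_op pi l] small, and with it [S - T]. *)
Lemma compress_inj : {in galg_closure pi &, injective compress}.
Proof.
move=> S T; rewrite !inE => dS dT ST; apply/funext => f.
have := galg_closureD dS (galg_closureZ (-1) dT).
move=> [bD hD]; apply/eqP; rewrite -subr_eq0 -scaleN1r; apply/eqP/l2norm_eq0.
apply/ler_addgt0Pr => e e0; rewrite add0r.
have F0 : 0 < 2 * (l2norm f + 1) by rewrite mulr_gt0// ltr_wpDl ?l2norm_ge0.
have d0 := divr_gt0 e0 F0.
have [l hl] := hD _ d0; have hl' := compress_approx hl.
have h1 : op_bound (e / (2 * (l2norm f + 1))) (galg_op ro l).
  move=> g; rewrite -l2normN -sub0r; apply: le_trans (hl' g).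
  rewrite /compress /= linearD linearZ /=.
  by rewrite -[pull ii (S _)]/(compress S g) ST /compress/= scaleN1r subrr.
have h2 := le_trans (pi_le_ro l) (opnorm_le (ltW d0) h1).
rewrite -(subrK (galg_op pi l f) (S f + _)).
apply: le_trans (l2normD _ _) _.
have h3 := op_bound_opnorm (galg_op_bounded rpi l) f.
have h4 := ler_wpM2r (l2norm_ge0 f) h2.
apply: le_trans (lerD (hl f) (le_trans h3 h4)) _.
have dE : e / (2 * (l2norm f + 1)) * (2 * (l2norm f + 1)) = e.
  by rewrite divfK// gt_eqF.
by move: dE (divr_gt0 e0 F0); set d := e / _; lra.
Qed.

(** Approximants of [T] are Cauchy under [ro], hence under [pi] by [pi_le_ro]; their limit under
    [pi] is the preimage. *)
Lemma compress_surj : galg_closure ro `<=` compress @` galg_closure pi.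
Proof.
move=> T [bT hT].
pose e n : K := (n%:R + 1)^-1.
have e0 n : 0 < e n by rewrite invr_gt0 ltr_wpDl.
have /choice[l hl] n : exists l, op_bound (e n) (fun f => T f - galg_op ro l f).
  exact: hT.
have cauchy n m :
    op_bound (e n + e m) (fun f => galg_op pi (l n) f - galg_op pi (l m) f).
  (* [pi_le_ro] speaks of a single element, so the difference is rewritten as one list, the same for
     both representations. *)
  have DE Z (si : G -> l2 K Z -> l2 K Z) :
      (fun f => galg_op si (l n) f - galg_op si (l m) f) =
      galg_op si (l n ++ [seq (-1 * p.1, p.2) | p <- l m]).
    by apply/funext => f; rewrite galg_op_cat galg_op_scale scaleN1r.
  have enm : 0 <= e n + e m by rewrite addr_ge0 ?ltW.
  have b1 : op_bound (e n + e m) (fun f => galg_op ro (l n) f - galg_op ro (l m) f).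
    move=> f; rewrite -(subrKA (T f)) -[X in X + _]opprB mulrDl.
    by apply: le_trans (l2normD _ _) _; rewrite l2normN; apply: lerD; exact: hl.
  rewrite DE in b1; rewrite DE.
  move: (l n ++ _) b1 => k /(opnorm_le enm)/(le_trans (pi_le_ro k)) h f.
  have hk := op_bound_opnorm (galg_op_bounded rpi k) f.
  exact: le_trans hk (ler_wpM2r (l2norm_ge0 f) h).
have [S bS hS] := op_limit (fun n => galg_op_bounded rpi (l n)) cauchy.
have hS' n : op_bound (4 * e n) (fun f => S f - galg_op pi (l n) f).
  by move=> f; rewrite -l2normN opprB; exact: hS.
exists S.
  split=> // d d0; suff [n hn] : exists n, 4 * e n <= d.
    exists (l n) => f; apply: le_trans (hS' n f) _.
    by rewrite ler_wpM2r ?l2norm_ge0.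
  exists (Num.bound (4 / d)); rewrite /e ler_pdivrMr ?ltr_wpDl//.
  have := archi_boundP (ltW (divr_gt0 (ltr0Sn K 3) d0)).
  rewrite ltr_pdivrMr// => h; nra.
apply/funext => f; apply/eqP; rewrite -subr_eq0; apply/eqP/l2norm_eq0.
(* Of the factor 5, 4 comes from compressing [hS'] and 1 from [hl]. *)
apply: (@le0_inv _ _ (5 * l2norm f)) => n.
rewrite -(subrKA (galg_op ro (l n) f)) -[X in _ + X]opprB.
apply: le_trans (l2normB _ _) _.
have h1 := compress_approx (hS' n) f; have h2 := hl n f.
have -> : 5 * l2norm f * (n%:R + 1)^-1 = 4 * e n * l2norm f + e n * l2norm f.
  by rewrite /e; ring.
exact: lerD.
Qed.

Lemma compress_adjoint T T' :
  adjoint_op T T' -> adjoint_op (compress T) (compress T').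
Proof.
move=> [bT bT' TT']; split; [exact: compress_bounded..|] => f g.
by rewrite /compress/= dot_pull TT' dot_push.
Qed.

Lemma galg_closure_iso : cstar_iso (galg_closure pi) (galg_closure ro).
Proof.
exists compress; split.
- split; [by move=> T /compress_closure|exact: compress_inj|exact: compress_surj].
- by move=> S T _ _; apply/funext => f; rewrite /compress/= linearD.
- by move=> c T _; apply/funext => f; rewrite /compress/= linearZ.
- move=> S T dS dT; apply/funext => f /=.
  by rewrite /compress/= -[X in S X](compressK f dT).
- by move=> T T' _; exact: compress_adjoint.
Qed.

End Isomorphism.

(** * Shifts and dilations *)

(** Functoriality, with the composite [k] given only up to pointwise equality, so that operator
    identities reduce to identities of index maps. *)
Lemma push_comp (K : realType) (X Y Z : choiceType) (i : X -> Y) (j : Y -> Z)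
    (k : X -> Z) (ii : injective i) (jj : injective j) (kk : injective k)
    (f : l2 K X) : (forall x, j (i x) = k x) -> push jj (push ii f) = push kk f.
Proof.
move=> jik; apply/esym/push_eq => [x|z kz]; first by rewrite -jik !pushE.
have [[y _ yz]|jz] := pselect (range j z); last by rewrite push_out.
rewrite -yz pushE push_out// => -[x _ xy]; apply: kz.
by exists x; rewrite // -jik xy.
Qed.

Section Relations.
Context {K : realType} {R : idomainType} {M : lmodType R}.
Local Notation H := (l2 K (M * nonzero R)%type).
Implicit Types (m n : M) (r s : nonzero R).

Definition shift_op m : H -> H := push (@shift_inj R M m).
Definition dilate_op r : H -> H := push (@dilate_inj R M r).

Lemma shift_op_delta m x : shift_op m (delta x) = delta (shift m x).
Proof. exact: push_delta. Qed.

Lemma dilate_op_delta r x : dilate_op r (delta x) = delta (dilate r x).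
Proof. exact: push_delta. Qed.

Lemma bounded_shift_op m : bounded_op (shift_op m).
Proof. exact: bounded_op_push. Qed.

Lemma bounded_dilate_op r : bounded_op (dilate_op r).
Proof. exact: bounded_op_push. Qed.

Lemma shift_op0 : shift_op 0 = id.
Proof.
apply: eq_bounded_op => [||x]; [exact: bounded_shift_op|exact: bounded_op_id|].
by rewrite shift_op_delta /shift scaler0 add0r -surjective_pairing.
Qed.

Lemma shift_opD m n : shift_op (m + n) = shift_op m \o shift_op n.
Proof.
apply/funext => f; apply/esym/push_comp => x.
by rewrite /shift/= scalerDr addrA.
Qed.

Lemma shift_op_rep : unitary_rep shift_op.
Proof.
split; [|exact: shift_op0|exact: shift_opD] => m.
by apply: unitary_op_push => x; exact: shift_surj.
Qed.

Lemma dilate_op1 : dilate_op nz_one = id.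
Proof.
apply: eq_bounded_op => [||[n s]]; [exact: bounded_dilate_op|exact: bounded_op_id|].
rewrite dilate_op_delta; congr (delta (_, _)).
by apply/val_inj; rewrite /= mul1r.
Qed.

Lemma dilate_opM r s : dilate_op (nz_mul r s) = dilate_op r \o dilate_op s.
Proof.
apply/funext => f; apply/esym/push_comp => -[n t]; congr (_, _).
by apply/val_inj; rewrite /= mulrA.
Qed.

(** For a unit [r], [dilate (nz_inv r)] inverts [dilate r], so pulling back along one is pushing
    forward along the other. *)
Lemma dilate_op_unit r : val r \is a GRing.unit ->
  unitary_op (dilate_op r) /\ adjoint_op (dilate_op r) (dilate_op (nz_inv r)).
Proof.
move=> ur; have dV : cancel (@dilate R M (nz_inv r)) (dilate r).
  by move=> [n s]; congr (_, _); apply/val_inj; rewrite /= mulVKr.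
split; first by apply: unitary_op_push => x; exists (dilate (nz_inv r) x).
have <- : pull (@dilate_inj R M r) = dilate_op (nz_inv r).
  apply: bounded_op_push_eq => [|x]; first exact: bounded_op_pull.
  by rewrite -{1}(dV x) pull_delta.
exact: adjoint_op_push.
Qed.

(** On indices this is [(r s) m = s (r m)], which uses commutativity of [R]. *)
Lemma shift_dilate m r :
  shift_op m \o dilate_op r = dilate_op r \o shift_op (val r *: m).
Proof.
apply: eq_bounded_op => [||[n s]]; try apply: bounded_op_comp;
  try exact: bounded_shift_op; try exact: bounded_dilate_op.
rewrite /= shift_op_delta !dilate_op_delta shift_op_delta.
by rewrite /shift /dilate /= scalerA mulrC.
Qed.

Lemma shift_cstar_iso :
  cstar_iso (cstar_gen (range shift_op)) (reduced_cstar K M).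
Proof.
rewrite /reduced_cstar (cstar_gen_rep shift_op_rep).
rewrite (cstar_gen_rep (@left_regular_rep K M)).
have unit_fibre_inj : injective (fun n : M => (n, @nz_one R)) by move=> n n' [].
apply: (galg_closure_iso shift_op_rep (ii := unit_fibre_inj)).
  move=> m f; rewrite left_regularE.
  (* Both sides are the push-forward along this one map, because [1 m = m] on the chosen fibre. *)
  have gi : injective (fun n : M => (m + n, @nz_one R)).
    by move=> n n' [/addrI].
  rewrite /shift_op (push_comp _ _ gi)// ?(push_comp _ _ gi)// => n.
  by rewrite /shift/= scale1r.
by move=> l; apply: galg_op_le_regular; exact: shift_op_rep.
Qed.

End Relations.

Theorem proposition1 (K : realType) (R : idomainType) (M : lmodType R) :
  (* the operators [U m] and [S r] exist and are determined by the formulas *)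
  (exists! U : M -> l2 K (M * nonzero R)%type -> l2 K (M * nonzero R)%type,
     translation_ops U) /\
  (exists! S : nonzero R -> l2 K (M * nonzero R)%type ->
                            l2 K (M * nonzero R)%type,
     multiplication_ops S) /\
  forall (U : M -> l2 K (M * nonzero R)%type -> l2 K (M * nonzero R)%type)
         (S : nonzero R -> l2 K (M * nonzero R)%type ->
                           l2 K (M * nonzero R)%type),
  translation_ops U -> multiplication_ops S ->
  [/\ (* (1) *)
      forall m : M, unitary_op (U m) /\ adjoint_op (U m) (U (- m)),
      (* (2) *)
      forall r : nonzero R, isometry_op (S r) /\
        (val r \is a GRing.unit ->
           unitary_op (S r) /\ adjoint_op (S r) (S (nz_inv r))),
      (* (3) *)
      unitary_rep U /\ cstar_iso (cstar_gen (range U)) (reduced_cstar K M),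
      (* (4) *)
      forall r s : nonzero R, S (nz_mul r s) = S r \o S s &
      (* (5) *)
      [/\ forall (m : M) (r : nonzero R),
            U m \o S r = S r \o U (val r *: m),
          forall (m : M) (r s : nonzero R) (rs0 : val r + val s != 0),
            U m \o S (nz_add rs0) =
            S (nz_add rs0) \o U (val r *: m) \o U (val s *: m),
          forall (m n : M) (r : nonzero R),
            U (m + n) \o S r = S r \o U (val r *: m) \o U (val r *: n),
          S nz_one = id &
          U 0 = id]].
Proof.
split.
  exists shift_op; split; first exact/translation_opsP.
  by move=> U /translation_opsP ->.
split.
  exists dilate_op; split; first exact/multiplication_opsP.
  by move=> S /multiplication_opsP ->.
move=> U S /translation_opsP -> /multiplication_opsP ->.
rewrite -/shift_op -/dilate_op.
split.
- move=> m; split; last exact: unitary_rep_adjoint shift_op_rep m.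
  by have [/(_ m)] := @shift_op_rep K R M.
- move=> r; split; [exact: isometry_op_push|exact: dilate_op_unit].
- by split; [exact: shift_op_rep|exact: shift_cstar_iso].
- exact: dilate_opM.
- split; [exact: shift_dilate| | |exact: dilate_op1|exact: shift_op0].
    move=> m r s rs0; rewrite shift_dilate -compA -shift_opD.
    by rewrite -scalerDl.
  by move=> m n r; rewrite shift_dilate -compA -shift_opD scalerDr.
Qed.
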